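(* Let $\mathcal{H}$ be a separable complex Hilbert space. Then $$\mathrm{wap}_{\mathcal{H}}(B(\mathcal{H}))=K(\mathcal{H})+\mathbb{C},$$ where $K(\mathcal{H})$ is the ideal of compact operators on $\mathcal{H}$ and $\mathbb{C}$ denotes the scalar multiples of the identity operator.
   Context: Let $U(\mathcal{H})$ be the group of all unitary operators on $\mathcal{H}$, a topological group for the weak operator topology (which coincides on it with the strong operator topology). For a topological group $G$, $C_b(G)$ is the $C^*$-algebra of bounded continuous functions $f:G\to\mathbb{C}$ with the sup norm. For $g\in G$, $(g\cdot f)(s)=f(g^{-1}s)$ is the left translate of $f$, and $Gf=\{g\cdot f: g\in G\}$. $C_{b,r}(G)$ is the $C^*$-subalgebra of all $f\in C_b(G)$ with $\|g\cdot f-f\|_\infty\to 0$ as $g\to 1$. $\mathrm{WAP}(G)$ is the set of all weakly almost periodic functions, i.e. all $f\in C_{b,r}(G)$ whose orbit $Gf$ is relatively compact in the weak topology of the Banach space $C_{b,r}(G)$. For $T\in B(\mathcal{H})$ and $\xi,\eta\in\mathcal{H}$, let $(\xi\star T\star\eta)(u)=\langle uTu^*\xi|\eta\rangle$ for $u\in U(\mathcal{H})$. The set $\mathrm{wap}_{\mathcal{H}}(B(\mathcal{H}))$ consists of all $T\in B(\mathcal{H})$ such that $\xi\star T\star\eta\in\mathrm{WAP}(U(\mathcal{H}))$ for all $\xi,\eta\in\mathcal{H}$. *)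

(* Defs.v *)
From HB Require Import structures.
From mathcomp Require Import all_boot all_order all_algebra monoid.
From mathcomp Require Import complex.
From mathcomp Require Import all_classical all_reals all_analysis.

Set Implicit Arguments.
Unset Strict Implicit.
Unset Printing Implicit Defensive.

Import Order.TTheory GRing.Theory Num.Theory.
Import numFieldNormedType.Exports.

Local Open Scope classical_set_scope.
Local Open Scope ring_scope.
Local Open Scope complex_scope.

Definition separable (T : topologicalType) : Prop :=
  exists2 D : set T, countable D & dense D.

(* The inner product of a Hilbert space is linear in its first argument and
   conjugate-linear in the second.  The scalars R[i] are given their topology
   and norm through the alias R[i]^o. *)
HB.mixin Record CompleteNormedModule_isHilbert (R : realType) H
    & CompleteNormedModule R[i] H := {
  inner : {dot H for @Num.conj R[i]};
  inner_norm : forall x : H, inner x x = `|x| ^+ 2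
}.

#[short(type="hilbertType")]
HB.structure Definition Hilbert (R : realType) :=
  {H of CompleteNormedModule R[i] H & CompleteNormedModule_isHilbert R H}.

HB.mixin Record isTopologicalGroup G & Group G & Topological G := {
  mulg_continuous : continuous (fun xy : G * G => (xy.1 * xy.2)%g);
  invg_continuous : continuous (fun x : G => (x^-1)%g)
}.

#[short(type="topGroupType")]
HB.structure Definition TopologicalGroup :=
  {G of Group G & Topological G & isTopologicalGroup G}.

Lemma continuous2_mulg (G : topGroupType) (T : topologicalType) (f h : T -> G)
    (x : T) : {for x, continuous f} -> {for x, continuous h} ->
  {for x, continuous (fun t => (f t * h t)%g)}.
Proof.
move=> cf ch.
apply: (@continuous_comp _ _ _ (fun t => (f t, h t)) (fun xy => xy.1 * xy.2)%g).
  exact: cvg_pair.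
exact: mulg_continuous.
Qed.

Section initial_lemmas.

Lemma cvg_initial (S : choiceType) (T : topologicalType) (f : S -> T)
    (F : set_system S) (s : S) : Filter F ->
  f x @[x --> F] --> f s -> F --> (s : initial_topology f).
Proof.
move=> FF Fs A; rewrite nbhsE => -[B [[C oC <-] Cs] BA].
by apply: filterS BA _; apply: Fs; exact: open_nbhs_nbhs.
Qed.

Lemma cvg_initial_ptws (S : choiceType) (I : Type) (T : topologicalType)
    (f : S -> {ptws I -> T}) (F : set_system S) (s : S) : Filter F ->
  (forall i, f x i @[x --> F] --> f s i) -> F --> (s : initial_topology f).
Proof.
move=> FF Fs; apply: cvg_initial; apply/cvg_sup => i.
by apply: cvg_initial; exact: Fs.
Qed.

Lemma initial_ptws_cvg (S : choiceType) (I : Type) (T : topologicalType)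
    (f : S -> {ptws I -> T}) (s : initial_topology f) (i : I) :
  f x i @[x --> s] --> f s i.
Proof.
apply: (@continuous_comp _ _ _ (f : initial_topology f -> _)
    (fun h : {ptws I -> T} => h i)); first exact: initial_continuous.
move=> A /(@initial_continuous _ _ (fun h : I -> T => h i) (f s)).
exact: ((cvg_sup _ _ _).1 (@cvg_id _ (nbhs (f s : {ptws I -> T}))) i).
Qed.

End initial_lemmas.

Section weak_topology.
Variables (K : numFieldType) (V : normedModType K).

Definition dual : Type := {phi : {linear V -> K^o} | continuous phi}.

Definition dual_eval (x : V) : {ptws dual -> K^o} := fun phi => sval phi x.

Definition weak_topology : Type := initial_topology dual_eval.

HB.instance Definition _ := Topological.on weak_topology.

Definition weakly_precompact (A : set V) : Prop :=
  precompact (A : set weak_topology).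

End weak_topology.

Definition left_translate (G : groupType) (T : Type) (g : G)
  (f : G -> T) : G -> T :=
  fun s => f (g^-1 * s)%g.

Section bounded_continuous.
Variables (R : realType) (G : topGroupType).
Implicit Types f : G -> R[i]^o.

Definition bounded_continuous f : Prop :=
  continuous f /\ [bounded f s | s in [set: G]].

Lemma bounded_setTP f :
  [bounded f s | s in [set: G]] <-> exists M, forall s, `|f s| <= M.
Proof.
have PF : ProperFilter (globally [set: G]).
  exact: (globally_properfilter (a := 1%g)).
rewrite ex_bound; split=> -[M fM]; exists M => s; first exact: fM.
by move=> _; exact: fM.
Qed.

Definition cb_pred : {pred (G -> R[i]^o)} :=
  fun f => `[< bounded_continuous f >].

Lemma cb_submod_closed : submod_closed cb_pred.
Proof.
split=> [|a f h /asboolP [cf /bounded_setTP[M fM]]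
  /asboolP [ch /bounded_setTP[N hN]]].
  apply/asboolP; split; first exact: cst_continuous.
  by apply/bounded_setTP; exists 0 => s; rewrite normr0.
apply/asboolP; split.
  move=> x; apply: (@cvgD _ R[i]^o); last exact: ch.
  by apply: cvgZr; exact: cf.
apply/bounded_setTP; exists (`|a| * M + N) => s.
apply: le_trans (ler_normD _ _) _; apply: lerD; last exact: hN.
by rewrite normrZ ler_wpM2l.
Qed.

HB.instance Definition _ :=
  GRing.isSubmodClosed.Build _ _ cb_pred cb_submod_closed.

(* cb is C_b(G); norms over R[i] take values in R[i], hence the cast in the
   supremum norm below. *)
Record cb := Cb { cb_fun :> G -> R[i]^o; cb_funP : cb_fun \in cb_pred }.
HB.instance Definition _ := [isSub for cb_fun].
HB.instance Definition _ := [Choice of cb by <:].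
HB.instance Definition _ := [SubChoice_isSubLmodule of cb by <:].

Definition cb_norm (f : cb) : R[i] :=
  (sup (range (fun s => complex.Re `|f s|)))%:C.

Lemma Re_normE (z : R[i]) : (complex.Re `|z|)%:C = `|z|.
Proof. by rewrite normc_def. Qed.

Lemma cb_normP (f : cb) (M : R[i]) :
  cb_norm f <= M <-> (forall s, `|f s| <= M).
Proof.
have /asboolP [_ /bounded_setTP[N fN]] := cb_funP f.
have Nr : forall L : R[i], (forall s, `|f s| <= L) -> L = (complex.Re L)%:C.
  move=> L fL; have : 0 <= L by apply: le_trans (fL 1%g).
  by case: L {fL} => a b; rewrite lecE /= => /andP[/eqP-> _].
have hs : has_sup (range (fun s => complex.Re `|f s|)).
  split; first by exists (complex.Re `|f 1%g|), 1%g.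
  exists (complex.Re N) => _ [s _ <-].
  by have := fN s; rewrite lecE => /andP[_].
split=> [fM s|fM].
  apply: le_trans fM; rewrite -Re_normE lecR.
  by apply: sup_upper_bound => //; exists s.
rewrite (Nr M fM) lecR; apply: ge_sup; first exact: hs.1.
by move=> _ [s _ <-]; have := fM s; rewrite lecE => /andP[_].
Qed.

Lemma cb_norm_ge (f : cb) s : `|f s| <= cb_norm f.
Proof. by apply: (cb_normP f _).1. Qed.

Lemma cb_ler_normD (f h : cb) : cb_norm (f + h) <= cb_norm f + cb_norm h.
Proof.
apply/cb_normP => s; apply: le_trans (ler_normD _ _) _.
by apply: lerD; exact: cb_norm_ge.
Qed.

Lemma cb_normrZ_le (a : R[i]) (f : cb) : cb_norm (a *: f) <= `|a| * cb_norm f.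
Proof.
apply/cb_normP => s; rewrite [leLHS]normrZ ler_wpM2l//; exact: cb_norm_ge.
Qed.

Lemma cb_normrZ (a : R[i]) (f : cb) : cb_norm (a *: f) = `|a| * cb_norm f.
Proof.
apply/eqP; rewrite eq_le cb_normrZ_le /=.
have [->|a0] := eqVneq a 0.
  by rewrite normr0 mul0r (le_trans _ (cb_norm_ge _ 1%g)).
rewrite -ler_pdivlMl ?normr_gt0// -normfV.
by apply: le_trans (cb_normrZ_le _ _); rewrite scalerA mulVf// scale1r.
Qed.

Lemma cb_normr0_eq0 (f : cb) : cb_norm f = 0 -> f = 0.
Proof.
move=> f0; apply/val_inj/funext => s; apply/(@normr0_eq0 _ R[i]^o)/eqP.
by rewrite eq_le normr_ge0 andbT; have := cb_norm_ge f s; rewrite f0.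
Qed.

HB.instance Definition _ :=
  Lmodule_isNormed.Build R[i] cb cb_ler_normD cb_normrZ cb_normr0_eq0.

Lemma cb_translate_subproof g (f : cb) : left_translate g f \in cb_pred.
Proof.
have /asboolP [cf /bounded_setTP[N fN]] := cb_funP f.
apply/asboolP; split; last by apply/bounded_setTP; exists N => s; exact: fN.
move=> s; apply: (@continuous_comp _ _ _ (fun s => g^-1 * s)%g); last exact: cf.
by apply: (@continuous2_mulg _ _ (cst g^-1%g) id) => //; exact: cvg_cst.
Qed.

Definition cb_translate g (f : cb) : cb := Cb (cb_translate_subproof g f).

End bounded_continuous.

Section right_uniform.
Variables (R : realType) (G : topGroupType).

Local Notation cb := (cb R G).

Lemma cb_translateD g (f h : cb) :
  cb_translate g (f + h) = cb_translate g f + cb_translate g h.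
Proof. exact: val_inj. Qed.

Lemma cb_translateZ g (a : R[i]) (f : cb) :
  cb_translate g (a *: f) = a *: cb_translate g f.
Proof. exact: val_inj. Qed.

Lemma cb_translateB g (f h : cb) :
  cb_translate g (f - h) = cb_translate g f - cb_translate g h.
Proof. exact: val_inj. Qed.

Lemma cb_translateM g k (f : cb) :
  cb_translate g (cb_translate k f) = cb_translate (g * k)%g f.
Proof.
by apply/val_inj/funext => s; rewrite /= /left_translate invgM mulgA.
Qed.

Lemma cb_translate1 (f : cb) : cb_translate 1%g f = f.
Proof.
by apply/val_inj/funext => s; rewrite /= /left_translate invg1 mul1g.
Qed.

Lemma norm_cb_translate g (f : cb) : `|cb_translate g f| = `|f|.
Proof.
suff le (h : G) (k : cb) : `|cb_translate h k| <= `|k|.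
  apply/eqP; rewrite eq_le le /=.
  by rewrite -[f in leLHS]cb_translate1 -(mulVg g) -cb_translateM le.
by apply/cb_normP => s; exact: (cb_norm_ge k (h^-1 * s)%g).
Qed.

Definition right_uniformly_continuous (f : cb) : Prop :=
  (`|cb_translate g f - f| : R[i]^o) @[g --> (1%g : G)] --> (0 : R[i]^o).

Definition cbr_pred : {pred cb} := fun f => `[< right_uniformly_continuous f >].

Lemma right_uniformly_continuousP (f : cb) :
  right_uniformly_continuous f <->
  cb_translate g f @[g --> (1%g : G)] --> f.
Proof.
split=> [/norm_cvg0P/subr_cvg0//|cf].
by apply/norm_cvg0P/subr_cvg0.
Qed.

Lemma cbr_submod_closed : submod_closed cbr_pred.
Proof.
split=> [|a f h /asboolP /right_uniformly_continuousP cf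
  /asboolP/right_uniformly_continuousP ch].
  apply/asboolP/right_uniformly_continuousP.
  have -> : (fun g => cb_translate g (0 : cb)) = cst 0.
    by apply/funext => g; exact: val_inj.
  exact: cvg_cst.
apply/asboolP/right_uniformly_continuousP.
under eq_fun do rewrite cb_translateD cb_translateZ.
by apply: cvgD ch; exact: cvgZr.
Qed.

HB.instance Definition _ :=
  GRing.isSubmodClosed.Build _ _ cbr_pred cbr_submod_closed.

(* C_{b,r}(G), with the norm inherited from C_b(G) *)
Record cbr := Cbr { cbr_cb :> cb; cbr_cbP : cbr_cb \in cbr_pred }.
HB.instance Definition _ := [isSub for cbr_cb].
HB.instance Definition _ := [Choice of cbr by <:].
HB.instance Definition _ := [SubChoice_isSubLmodule of cbr by <:].

Definition cbr_norm (f : cbr) : R[i] := `|cbr_cb f|.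

Lemma cbr_ler_normD (f h : cbr) : cbr_norm (f + h) <= cbr_norm f + cbr_norm h.
Proof. exact: ler_normD. Qed.

Lemma cbr_normrZ (a : R[i]) (f : cbr) : cbr_norm (a *: f) = `|a| * cbr_norm f.
Proof. exact: normrZ. Qed.

Lemma cbr_normr0_eq0 (f : cbr) : cbr_norm f = 0 -> f = 0.
Proof. by move=> /normr0_eq0 f0; exact: val_inj. Qed.

HB.instance Definition _ :=
  Lmodule_isNormed.Build R[i] cbr cbr_ler_normD cbr_normrZ cbr_normr0_eq0.

Lemma cbr_translate_subproof g (f : cbr) : cb_translate g f \in cbr_pred.
Proof.
have /asboolP cf := cbr_cbP f; apply/asboolP.
rewrite /right_uniformly_continuous.
have -> : (fun h => `|cb_translate h (cb_translate g f) - cb_translate g f|) =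
    (fun h => `|cb_translate h f - f|) \o (fun h => g^-1 * (h * g))%g.
  apply/funext => h /=.
  rewrite -(norm_cb_translate g (_ - cbr_cb f)) cb_translateB.
  by rewrite !cb_translateM mulVKg.
have e1 : (g^-1 * (1 * g))%g = 1%g :> G by rewrite (mul1g g) (mulVg g).
have : (g^-1 * (h * g))%g @[h --> (1%g : G)] --> (g^-1 * (1 * g))%g.
  apply: (@continuous2_mulg _ _ (cst g^-1%g) (fun h => h * g)%g 1%g).
    exact: cvg_cst.
  by apply: (@continuous2_mulg _ _ id (cst g)) => //; exact: cvg_cst.
by rewrite e1 => cg; exact: (cvg_comp _ _ cg cf).
Qed.

Definition cbr_translate g (f : cbr) : cbr := Cbr (cbr_translate_subproof g f).

Definition WAP : set (G -> R[i]^o) :=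
  [set f | exists2 F : cbr,
    (F : G -> R[i]^o) = f & weakly_precompact (range (cbr_translate^~ F))].

End right_uniform.

Section inner_lemmas.
Variables (R : realType) (H : hilbertType R).
Implicit Types x y : H.

Lemma inner_conj x y : inner x y = Num.conj (inner y x).
Proof. by rewrite (hermC _ x y) expr0 mul1r. Qed.

Lemma cauchy_schwarz x y : `|inner x y| <= `|x| * `|y|.
Proof.
have [->|y0] := eqVneq y 0; first by rewrite linear0r !normr0 mulr0.
have [a aE] : exists a : R[i], a = `|y| ^+ 2 by eexists.
pose b := inner x y.
have a0 : 0 < a by rewrite aE exprn_gt0// normr_gt0.
have d_E : inner (a *: x) (b *: y) = a * `|b| ^+ 2.
  by rewrite linearZl_LR linearZr_LR /= normCK -/b [_^* * _]mulrC.
have : 0 <= inner (a *: x - b *: y) (a *: x - b *: y).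
  by rewrite inner_norm exprn_ge0.
rewrite dnormB d_E !dnormZ !inner_norm -aE (gtr0_norm a0).
rewrite (@geC0_conj _ (a * _)) ?mulr_ge0 ?exprn_ge0 ?(ltW a0)//.
rewrite [`|b| ^+ 2 * a]mulrC opprD addrA addrK subr_ge0 [a ^+ 2]expr2 -mulrA.
rewrite ler_pM2l// aE -exprMn mulrC => h.
by rewrite -(@ler_pXn2r _ 2) ?nnegrE ?mulr_ge0.
Qed.

Lemma continuous_inner_l y : continuous (inner^~ y : H -> R[i]^o).
Proof.
apply: (@bounded_linear_continuous _ H R[i]^o (applyr inner y)).
apply/linear_boundedP; exists `|y|; split; first exact: normr_real.
move=> r yr x; apply: le_trans (cauchy_schwarz x y) _.
by rewrite mulrC ler_wpM2r// ltW.
Qed.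

End inner_lemmas.

(* A unitary operator u is packed with its adjoint u^*, and the two conditions
   u^* u = 1 and u u^* = 1; u^* is determined by u. *)
Section unitary.
Variables (R : realType) (H : hilbertType R).

Record unitary : Type := Unitary {
  unitary_fun :> {linear H -> H};
  adjoint : {linear H -> H};
  adjointE : forall x y, inner (unitary_fun x) y = inner x (adjoint y);
  adjointK : cancel unitary_fun adjoint;
  adjointVK : cancel adjoint unitary_fun
}.

Lemma linear_ext (f g : {linear H -> H}) : f =1 g -> f = g.
Proof.
case: f g => f cf [g cg] /= /funext fg; rewrite {}fg in cf *.
congr GRing.Linear.Pack; case: cf cg => [[a] [b]] [[c] [d]].
by rewrite (Prop_irrelevance a c) (Prop_irrelevance b d).
Qed.

Lemma unitary_ext (u v : unitary) : u =1 v -> u = v.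
Proof.
case: u v => [u u' uP uK uV] [v v' vP vK vV] /= uv.
have euv : u = v by exact: linear_ext.
rewrite {}euv in uP uK uV uv *.
have e' : u' = v' by apply: linear_ext => x; rewrite -[x in LHS]vV uK.
rewrite {}e' in uP uK uV *; congr Unitary; exact: Prop_irrelevance.
Qed.

HB.instance Definition _ := gen_eqMixin unitary.
HB.instance Definition _ := gen_choiceMixin unitary.

Definition unitary1 : unitary := @Unitary idfun idfun
  (fun x y => erefl) (fun x => erefl) (fun x => erefl).

Lemma adjointVE (u : unitary) x y : inner (adjoint u x) y = inner x (u y).
Proof. by rewrite inner_conj -adjointE -inner_conj. Qed.

Definition unitary_inv (u : unitary) : unitary :=
  @Unitary (adjoint u) u (adjointVE u) (adjointVK u) (adjointK u).

Lemma unitary_mul_subproof (u v : unitary) x y :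
  inner ((u \o v) x) y = inner x ((adjoint v \o adjoint u) y).
Proof. by rewrite /= !adjointE. Qed.

Definition unitary_mul (u v : unitary) : unitary :=
  @Unitary (u \o v) (adjoint v \o adjoint u) (unitary_mul_subproof u v)
    (can_comp (adjointK u) (adjointK v))
    (can_comp (adjointVK v) (adjointVK u)).

Lemma unitary_mulA : associative unitary_mul.
Proof. by move=> u v w; exact: unitary_ext. Qed.
Lemma unitary_mul1 : left_id unitary1 unitary_mul.
Proof. by move=> u; exact: unitary_ext. Qed.
Lemma unitary_1mul : right_id unitary1 unitary_mul.
Proof. by move=> u; exact: unitary_ext. Qed.
Lemma unitary_mulV : left_inverse unitary1 unitary_inv unitary_mul.
Proof. by move=> u; apply: unitary_ext => x /=; exact: adjointK. Qed.
Lemma unitary_Vmul : right_inverse unitary1 unitary_inv unitary_mul.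
Proof. by move=> u; apply: unitary_ext => x /=; exact: adjointVK. Qed.

HB.instance Definition _ := isGroup.Build unitary unitary_mulA unitary_mul1
  unitary_1mul unitary_mulV unitary_Vmul.

(* The initial topology of matrix_coef is the weak operator topology. *)
Definition matrix_coef (u : unitary) : {ptws H * H -> R[i]^o} :=
  fun xy => inner (u xy.1) xy.2.

HB.instance Definition _ :=
  Topological.copy unitary (initial_topology matrix_coef).

Lemma unitary_cvg (T : Type) (F : set_system T) (f : T -> unitary)
    (u : unitary) : Filter F ->
  f @ F --> u <-> forall x y,
    (inner (f t x) y : R[i]^o) @[t --> F] --> (inner (u x) y : R[i]^o).
Proof.
move=> FF; split=> [Fu x y|Fu].
  exact: (cvg_comp _ _ Fu (@initial_ptws_cvg _ _ _ matrix_coef u (x, y))).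
by apply: (@cvg_initial_ptws _ _ _ matrix_coef) => -[x y]; exact: Fu.
Qed.

Lemma norm_unitary (u : unitary) x : `|u x| = `|x|.
Proof.
apply/eqP; rewrite -(eqrXn2 (n := 2)) ?normr_ge0//.
by rewrite -!inner_norm adjointE adjointK.
Qed.

Lemma unitary_cvg_strong (T : Type) (F : set_system T) (f : T -> unitary)
    (u : unitary) : Filter F ->
  f @ F --> u -> forall x, f t x @[t --> F] --> u x.
Proof.
move=> FF /unitary_cvg Fu x; apply/cvgrPdistC_lt => e e0.
have e2 : 0 < e ^+ 2 / 2 by rewrite divr_gt0 ?exprn_gt0.
have /cvgrPdist_lt/(_ _ e2) := Fu x (u x); apply: filterS => t.
rewrite inner_norm norm_unitary => h.
rewrite -(@ltr_pXn2r _ 2) ?nnegrE ?(ltW e0)//.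
rewrite -inner_norm dnormB !inner_norm !norm_unitary.
set d := inner _ _ in h *.
have -> : `|x| ^+ 2 + `|x| ^+ 2 - (d + Num.conj d) =
    (`|x| ^+ 2 - d) + Num.conj (`|x| ^+ 2 - d).
  by rewrite rmorphB /= (geC0_conj (exprn_ge0 2 (normr_ge0 x))) opprD addrACA.
have r : (`|x| ^+ 2 - d) + Num.conj (`|x| ^+ 2 - d) \is Num.real.
  by rewrite CrealE rmorphD /= conjCK addrC.
apply: le_lt_trans (real_ler_norm r) _; apply: le_lt_trans (ler_normD _ _) _.
by rewrite norm_conjC (splitr (e ^+ 2)) ltrD.
Qed.

Lemma unitary_mulg_continuous :
  continuous (fun uv : unitary * unitary => (uv.1 * uv.2)%g).
Proof.
move=> [u v]; apply/unitary_cvg => x y /=.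
have c1 : fst @ nbhs (u, v) --> u by exact: cvg_fst.
have c2 : snd @ nbhs (u, v) --> v by exact: cvg_snd.
have -> : (fun w : unitary * unitary => inner (w.1 (w.2 x)) y) =
  (fun w => inner (w.2 x - v x) (adjoint w.1 y) + inner (w.1 (v x)) y).
  by apply/funext => w; rewrite -adjointE linearB/= linearBl subrK.
rewrite -[X in _ --> X]add0r; apply: (@cvgD _ R[i]^o); last first.
  by have /unitary_cvg := c1; exact.
apply/(@cvgr0Pnorm_le _ R[i]^o) => e e0.
have d0 : 0 < e / (`|y| + 1) by rewrite divr_gt0// ltr_wpDl.
have c3 := @unitary_cvg_strong _ _ snd v (nbhs_filter (u, v)) c2 x.
have /cvgrPdistC_lt/(_ _ d0) := c3; apply: filterS => w h.
apply: le_trans (cauchy_schwarz _ _) _.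
rewrite (norm_unitary (w.1^-1)%g) (le_trans (ler_wpM2r _ (ltW h)))//.
by rewrite mulrAC ler_pdivrMr ?ltr_wpDl// ler_wpM2l ?(ltW e0)// lerDl.
Qed.

Lemma unitary_invg_continuous : continuous (fun u : unitary => (u^-1)%g).
Proof.
move=> u.
apply/(@unitary_cvg _ (nbhs u) _ (u^-1)%g (nbhs_filter u)) => x y /=.
have c := (@unitary_cvg _ (nbhs u) id u (nbhs_filter u)).1 cvg_id y x.
apply/cvgrPdist_lt => e e0; have /cvgrPdist_lt/(_ _ e0) := c.
apply: filterS => v.
have invE (w : unitary) : inner (adjoint w x) y = Num.conj (inner (w y) x).
  by rewrite inner_conj -adjointE.
by rewrite !invE -rmorphB norm_conjC.
Qed.

HB.instance Definition _ := isTopologicalGroup.Build unitary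
  unitary_mulg_continuous unitary_invg_continuous.

Definition orbit_coef (xi eta : H) (T : {linear H -> H}) : unitary -> R[i]^o :=
  fun u => inner (u (T (adjoint u xi))) eta.

Definition bounded_op : set {linear H -> H} := [set T | continuous T].

Definition compact_op : set {linear H -> H} :=
  bounded_op `&` [set T | precompact (T @` [set x | `|x| <= 1])].

Definition wap_op : set {linear H -> H} :=
  bounded_op `&` [set T | forall xi eta, WAP (orbit_coef xi eta T)].

Definition scalar_op : set {linear H -> H} :=
  range (fun c : R[i] => c \*: idfun : {linear H -> H}).

End unitary.

Arguments bounded_op {R} H _.
Arguments compact_op {R} H _.
Arguments wap_op {R} H _.
Arguments scalar_op {R} H _.

(* Main.v *)
From HB Require Import structures.
Require Import Defs.
From mathcomp Require Import all_boot all_order all_algebra complex monoid.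
From mathcomp Require Import all_classical all_reals all_analysis.
From mathcomp Require Import ring lra.

(** Why the theorem holds. Write [f(u) = <u T u^* xi, eta>] for a coefficient
    of [T]; its translate by [g] is the coefficient at [g xi], [g eta].

    Let [T = K + c] with [K] compact. The scalar part of [f] is the constant
    [c <xi, eta>], which every translation fixes, so only [K] matters. The
    translates then lie in the set of coefficients of [K] at [x], [y] in a ball.
    This ball is weakly compact (weak_limit), and it remains to see that a
    functional [phi] on the algebra gives a form [B(x, y)], the value of [phi] at
    the coefficient at [x], [y], which is jointly weakly continuous on the ball.
    A form is so when it is compact, that is, arbitrarily small as soon as its
    second argument is orthogonal to a suitable finite orthonormal family
    (compact_form_cvg). If [B] were not compact, there would be arbitrarily long
    families of unit vectors [a_i] and orthonormal vectors [b_i] with all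
    [|B(a_i, b_i)|] above some [e > 0] (compact_form_of_sums). But the sum of
    these moduli is at most the norm of [phi] times the supremum over [u] of
    [sum_i |<K u^* a_i, u^* b_i>|], and such a sum is [o(n)] in the number [n] of
    terms, because [K] maps the ball close to a finite set and each vector of
    that set satisfies Bessel's inequality (compact_op_sums).

    Conversely let all coefficients of [T] be weakly almost periodic. For such a
    function [f] the two iterated limits of [f(g_n s_m)] agree
    (WAP_double_limit). Suppose that, orthogonally to any finite set, there are
    orthonormal [x], [y] with [|<T x, x> - <T y, y>| >= e]. One builds jointly
    orthonormal sequences [e_n], [d_n] of such vectors, lets [g_n^*] carry [e_0]
    to [e_n], and lets [s_m^*] carry [e_n] to [d_n] for [n <= m] and fix it for
    [n > m]. Then the coefficient at [e_0] takes at [g_n s_m] the value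
    [<T e_n, e_n>] for [n > m] and [<T d_n, d_n>] for [n <= m], and the iterated
    limits differ (wap_op_swaps). Hence the diagonal [<T x, x>] converges to a
    scalar [c] along unit vectors orthogonal to ever larger finite sets
    (diagonal_limit). By polarization the compressions of [T - c] to the
    complements of finite dimensional subspaces tend to zero, which makes
    [T - c] compact (small_compression_compact).

    Weak compactness and iterated limits are handled with ultrafilters
    throughout: bounded complex functions converge along them. *)

Set Implicit Arguments.
Unset Strict Implicit.
Unset Printing Implicit Defensive.

Import Order.TTheory GRing.Theory Num.Theory.
Import numFieldNormedType.Exports.

Local Open Scope classical_set_scope.
Local Open Scope ring_scope.
Local Open Scope complex_scope.

(** * Real-valued norms and limits along ultrafilters *)

Section real_norm.
Variable R : realType.

(** Norms over [R[i]] are complex numbers, whose order is partial; estimates are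
    carried out on their real parts, in a totally ordered field. *)
Definition rnorm (V : normedZmodType R[i]) (x : V) : R := complex.Re `|x|.

Section zmod.
Variable V : normedZmodType R[i].
Implicit Types x y : V.

Lemma rnormE x : `|x| = (rnorm x)%:C.
Proof. by rewrite /rnorm RRe_real. Qed.

Lemma rnorm_le x (M : R) : (`|x| <= M%:C) = (rnorm x <= M).
Proof. by rewrite rnormE lecR. Qed.

Lemma rnorm_ge0 x : 0 <= rnorm x.
Proof. by rewrite -lecR -rnormE normr_ge0. Qed.

Lemma rnorm0 : rnorm (0 : V) = 0.
Proof. by rewrite /rnorm normr0. Qed.

Lemma rnorm0_eq0 x : rnorm x = 0 -> x = 0.
Proof. by move=> x0; apply/eqP; rewrite -normr_eq0 rnormE x0. Qed.

Lemma rnormD x y : rnorm (x + y) <= rnorm x + rnorm y.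
Proof. by rewrite -lecR rmorphD /= -!rnormE ler_normD. Qed.

Lemma rnormN x : rnorm (- x) = rnorm x.
Proof. by rewrite /rnorm normrN. Qed.

Lemma rnormBC x y : rnorm (x - y) = rnorm (y - x).
Proof. by rewrite /rnorm distrC. Qed.

Lemma rnormB x y : rnorm (x - y) <= rnorm x + rnorm y.
Proof. by rewrite -[rnorm y]rnormN rnormD. Qed.

Lemma rnorm_sum (I : Type) (r : seq I) (f : I -> V) :
  rnorm (\sum_(i <- r) f i) <= \sum_(i <- r) rnorm (f i).
Proof.
elim: r => [|i r IH]; first by rewrite !big_nil rnorm0.
by rewrite !big_cons (le_trans (rnormD _ _))// lerD2l.
Qed.

End zmod.

Lemma rnormM (a b : R[i]) : rnorm (a * b) = rnorm a * rnorm b.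
Proof. by apply: complexI; rewrite rmorphM /= -!rnormE normrM. Qed.

Lemma rnormZ (V : normedModType R[i]) (a : R[i]) (x : V) :
  rnorm (a *: x) = rnorm a * rnorm x.
Proof. by apply: complexI; rewrite rmorphM /= -!rnormE normrZ. Qed.

Lemma rnorm_real (a : R) : rnorm a%:C = `|a|.
Proof. by rewrite /rnorm normc_def /= expr0n addr0 sqrtr_sqr. Qed.

Lemma rnorm_conj (a : R[i]) : rnorm (Num.conj a) = rnorm a.
Proof. by rewrite /rnorm norm_conjC. Qed.

Lemma rnorm_ge_Re (a : R[i]) : `|complex.Re a| <= rnorm a.
Proof. by rewrite -lecR -rnormE normc_ge_Re. Qed.

Lemma Re_le_rnorm (a : R[i]) : complex.Re a <= rnorm a.
Proof. exact: le_trans (ler_norm _) (rnorm_ge_Re a). Qed.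

Lemma rnorm_i : rnorm ('i%C : R[i]) = 1.
Proof. by rewrite /rnorm normc_def /= expr0n add0r expr1n sqrtr1. Qed.

Lemma rnorm_ge_Im (a : R[i]) : `|complex.Im a| <= rnorm a.
Proof.
have := rnorm_ge_Re (a * 'i%C); rewrite ReiNIm normrN rnormM.
by rewrite rnorm_i mulr1.
Qed.

Lemma rnorm_le_ReIm (a : R[i]) :
  rnorm a <= `|complex.Re a| + `|complex.Im a|.
Proof.
rewrite {1}[a]complexE; apply: le_trans (rnormD _ _) _.
by rewrite rnormM rnorm_i mul1r !rnorm_real.
Qed.

Lemma cvg_rnormP (V : normedModType R[i]) T (F : set_system T) {FF : Filter F}
    (f : T -> V) (l : V) :
  f @ F --> l <-> forall e : R, 0 < e -> \forall t \near F, rnorm (l - f t) < e.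
Proof.
split=> [fl e e0|fl].
  have /cvgrPdist_lt/(_ e%:C) := fl; rewrite ltcR => /(_ e0).
  by apply: filterS => t; rewrite rnormE ltcR.
apply/cvgrPdist_lt => -[a b]; rewrite ltcE /= => /andP[/eqP-> a0].
by have := fl _ a0; apply: filterS => t; rewrite rnormE ltcR.
Qed.

Lemma cvg_rnorm_le (V : normedModType R[i]) T (F : set_system T)
    {FF : Filter F} (f : T -> V) (l : V) :
  (forall e : R, 0 < e -> \forall t \near F, rnorm (f t - l) <= e) ->
  f @ F --> l.
Proof.
move=> fl; apply/cvg_rnormP => e e0.
have e2 : 0 < e / 2 by rewrite divr_gt0.
have := fl _ e2; apply: filterS => t; rewrite rnormBC => /le_lt_trans; apply.
by rewrite gtr_pMr// invf_lt1// ltr1n.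
Qed.

Lemma cvg_rnorm_lt (V : normedModType R[i]) T (F : set_system T)
    {FF : Filter F} (f : T -> V) (l : V) (e : R) : f @ F --> l -> 0 < e ->
  \forall t \near F, rnorm (f t - l) < e.
Proof.
by move=> /cvg_rnormP fl /fl; apply: filterS => t; rewrite rnormBC.
Qed.

Lemma cvg_lim_rnorm (V : normedModType R[i]) T (F : set_system T)
    {FF : ProperFilter F} (f : T -> V) (l a : V) (M : R) : f @ F --> l ->
  (\forall t \near F, rnorm (f t - a) <= M) -> rnorm (l - a) <= M.
Proof.
move=> fl fM; apply/ler_addgt0Pr => e e0.
have [t [h1 h2]] := @filter_ex _ F _ _ (filterI fM (cvg_rnorm_lt fl e0)).
rewrite -(subrKA (f t)); apply: le_trans (rnormD _ _) _.
by rewrite addrC lerD// rnormBC ltW.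
Qed.

End real_norm.

Section ultralimits.

Lemma ultra_fmap T U (f : T -> U) (F : set_system T) :
  UltraFilter F -> UltraFilter (f @ F).
Proof.
move=> FU; split=> [|G GF FG]; first exact: fmap_proper_filter.
rewrite predeqE => A; split=> [GA|]; last exact: FG.
have [//|FnA] := in_ultra_setVsetC (f @^-1` A) FU.
have /filterI /(_ GA) : G (~` A) by apply: FG.
by rewrite setICl => /filter_ex[].
Qed.

Variable R : realType.

Lemma ultra_cvg_real T (F : set_system T) (f : T -> R) (M : R) :
  UltraFilter F -> (\forall t \near F, `|f t| <= M) ->
  exists l : R, f @ F --> l.
Proof.
move=> FU fM; have := @segment_compact R (- M) M; rewrite compact_ultra.
move=> /(_ _ (ultra_fmap f FU)) []; last by move=> l [_ fl]; exists l.
by apply: filterS fM => t; rewrite /= in_itv /= ler_norml.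
Qed.

(** Bounded complex-valued functions converge along ultrafilters: the real and
    imaginary parts live in a compact interval. *)
Lemma ultra_cvg T (F : set_system T) (f : T -> R[i]^o) (M : R) :
  UltraFilter F -> (\forall t \near F, rnorm (f t) <= M) ->
  exists l : R[i]^o, f @ F --> l.
Proof.
move=> FU fM.
have [|a fa] := @ultra_cvg_real T F (fun t => complex.Re (f t)) M FU.
  by apply: filterS fM => t; apply: le_trans; exact: rnorm_ge_Re.
have [|b fb] := @ultra_cvg_real T F (fun t => complex.Im (f t)) M FU.
  by apply: filterS fM => t; apply: le_trans; exact: rnorm_ge_Im.
exists (a +i* b); apply/cvg_rnormP => e e0.
have e2 : 0 < e / 2 by rewrite divr_gt0.
move/cvgrPdist_lt : fa => /(_ _ e2); move/cvgrPdist_lt : fb => /(_ _ e2).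
apply: filterS2 => t hb ha; apply: le_lt_trans (rnorm_le_ReIm _) _.
by rewrite [e]splitr; case: (f t) ha hb => x y /= ha hb; rewrite ltrD.
Qed.

Lemma ultra_nat : exists2 F : set_system nat, UltraFilter F & \oo `<=` F.
Proof. by have [F []] := ultraFilterLemma eventually_filter; exists F. Qed.

End ultralimits.

Lemma cvg_rnorm_unique (R : realType) (V : normedModType R[i]) T
    (F : set_system T) {FF : ProperFilter F} (f : T -> V) (a b : V) :
  f @ F --> a -> f @ F --> b -> a = b.
Proof.
move=> fa fb; apply/eqP; rewrite -subr_eq0; apply/eqP/rnorm0_eq0/eqP.
rewrite eq_le rnorm_ge0 andbT; apply/ler_addgt0Pr => e e0; rewrite add0r.
apply: cvg_lim_rnorm fa _; apply: filterS (cvg_rnorm_lt fb e0) => t.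
exact: ltW.
Qed.

(** * Orthonormal families, representation of functionals, weak limits *)

Lemma continuous_linear_rnormP (R : realType) (V W : normedModType R[i])
    (f : {linear V -> W}) :
  continuous f <->
  exists2 M : R, 0 <= M & forall x, rnorm (f x) <= M * rnorm x.
Proof.
split=> [/linear_bounded_continuous/linear_boundedP [r [rr fr]]|[M M0 fM]].
  exists (rnorm (r + 1)) => [|x]; first exact: rnorm_ge0.
  rewrite -rnorm_le rmorphM /= -!rnormE.
  apply: fr; rewrite real_ltNge ?realD ?normr_real//.
  apply/negP => /(le_trans (real_ler_norm _)); rewrite realD// => /(_ isT).
  by rewrite gerDl ler10.
apply: bounded_linear_continuous; apply/linear_boundedP; exists M%:C.
split=> [|r Mr x]; first by apply/complex_realP; exists M.
apply: le_trans (ler_wpM2r (normr_ge0 x) (ltW Mr)).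
by rewrite [leRHS](_ : _ = (M * rnorm x)%:C) ?rnorm_le// rmorphM /= -rnormE.
Qed.

Section hilbert.
Variables (R : realType) (H : hilbertType R).
Implicit Types (x y z : H) (s : seq H).

Lemma innerDl x y z : inner (x + y) z = inner x z + inner y z.
Proof. exact: linearDl. Qed.
Lemma innerBl x y z : inner (x - y) z = inner x z - inner y z.
Proof. exact: linearBl. Qed.
Lemma innerZl (a : R[i]) x y : inner (a *: x) y = a * inner x y.
Proof. by rewrite linearZl_LR. Qed.
Lemma innerDr x y z : inner x (y + z) = inner x y + inner x z.
Proof. exact: linearDr. Qed.
Lemma innerBr x y z : inner x (y - z) = inner x y - inner x z.
Proof. exact: linearBr. Qed.
Lemma innerZr (a : R[i]) x y : inner x (a *: y) = Num.conj a * inner x y.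
Proof. by rewrite linearZr_LR. Qed.

Lemma inner_suml (I : Type) (r : seq I) (f : I -> H) z :
  inner (\sum_(i <- r) f i) z = \sum_(i <- r) inner (f i) z.
Proof. exact: linear_sumlz. Qed.

Lemma inner_eq0_sym x y : inner x y = 0 -> inner y x = 0.
Proof. by rewrite inner_conj => /(canRL conjCK) ->; rewrite conjC0. Qed.

Lemma innerE x : inner x x = (rnorm x ^+ 2)%:C.
Proof. by rewrite inner_norm rnormE rmorphXn. Qed.

Lemma rnorm_inner x y : rnorm (inner x y) <= rnorm x * rnorm y.
Proof. by rewrite -rnorm_le rmorphM /= -!rnormE cauchy_schwarz. Qed.

Lemma rnorm_innerC x y : rnorm (inner x y) = rnorm (inner y x).
Proof. by rewrite inner_conj rnorm_conj. Qed.

Lemma ReJ (a : R[i]) : complex.Re (Num.conj a) = complex.Re a.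
Proof. by case: a. Qed.

Lemma ReD (a b : R[i]) : complex.Re (a + b) = complex.Re a + complex.Re b.
Proof. by case: a; case: b. Qed.

Lemma ReB (a b : R[i]) : complex.Re (a - b) = complex.Re a - complex.Re b.
Proof. by case: a; case: b. Qed.

Lemma ReZ (t : R) (a : R[i]) : complex.Re (t%:C * a) = t * complex.Re a.
Proof. by case: a => a b /=; rewrite mul0r subr0. Qed.

Lemma rnorm_sqrD x y :
  rnorm (x + y) ^+ 2 = rnorm x ^+ 2 + rnorm y ^+ 2 + 2 * complex.Re (inner x y).
Proof.
apply: complexI; rewrite -innerE innerDl !innerDr [inner y x]inner_conj !innerE.
by apply/eqP; case: (inner x y) => a b; rewrite eq_complex /=; apply/andP;
  split; apply/eqP; ring.
Qed.

Lemma rnorm_sqrB x y :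
  rnorm (x - y) ^+ 2 = rnorm x ^+ 2 + rnorm y ^+ 2 - 2 * complex.Re (inner x y).
Proof.
rewrite rnorm_sqrD rnormN -scaleN1r innerZr rmorphN1 mulN1r.
by congr (_ + _); case: (inner x y) => a b /=; rewrite mulrN.
Qed.

Definition perp x s : Prop := forall y, y \in s -> inner x y = 0.

Fixpoint orthonormal_seq s : Prop :=
  if s is x :: s' then [/\ rnorm x = 1, perp x s' & orthonormal_seq s']
  else True.

Definition oproj s x : H := \sum_(e <- s) inner x e *: e.

Lemma perp_cons x y s : perp x (y :: s) <-> inner x y = 0 /\ perp x s.
Proof.
split=> [xs|[xy xs] z]; last by rewrite inE => /orP[/eqP->|/xs].
by split=> [|z zs]; apply: xs; rewrite inE ?eqxx// zs orbT.
Qed.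

Lemma perp_oproj x z s : perp x s -> inner (oproj s z) x = 0.
Proof.
move=> xs; rewrite /oproj inner_suml big_seq big1// => e es.
by rewrite innerZl (inner_eq0_sym (xs e es)) mulr0.
Qed.

Lemma sub_oproj_perp s x : orthonormal_seq s -> perp (x - oproj s x) s.
Proof.
elim: s => [_ y//|e s IH /= [e1 es os]].
rewrite /oproj big_cons -/(oproj s x); apply/perp_cons; split.
  rewrite innerBl innerDl innerZl innerE e1 expr1n mulr1 perp_oproj// addr0.
  exact: subrr.
move=> d ds; rewrite innerBl innerDl innerZl es// mulr0 add0r -innerBl.
exact: IH.
Qed.

Lemma rnorm_sqr_unit x e : rnorm e = 1 ->
  rnorm x ^+ 2 = rnorm (x - inner x e *: e) ^+ 2 + rnorm (inner x e) ^+ 2.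
Proof.
move=> e1; rewrite rnorm_sqrB rnormZ e1 mulr1 innerZr -normCKC ?rnormE.
by rewrite -rmorphXn /=; ring.
Qed.

Lemma oproj_cons e s x : perp e s ->
  oproj (e :: s) x = inner x e *: e + oproj s (x - inner x e *: e).
Proof.
move=> es; rewrite /oproj big_cons; congr (_ + _).
apply: eq_big_seq => d ds.
by rewrite innerBl innerZl es// mulr0 subr0.
Qed.

Lemma rnorm_sub_oproj s x :
  orthonormal_seq s -> rnorm (x - oproj s x) <= rnorm x.
Proof.
elim: s x => [x _|e s IH x /= [e1 es os]].
  by rewrite /oproj big_nil subr0.
rewrite oproj_cons// opprD addrA; apply: le_trans (IH _ os) _.
rewrite -(@ler_pXn2r _ 2) ?nnegrE ?rnorm_ge0// (rnorm_sqr_unit x e1).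
by rewrite lerDl sqr_ge0.
Qed.

Lemma bessel s x : orthonormal_seq s ->
  \sum_(e <- s) rnorm (inner x e) ^+ 2 <= rnorm x ^+ 2.
Proof.
elim: s x => [x _|e s IH x /= [e1 es os]].
  by rewrite big_nil sqr_ge0.
rewrite big_cons (rnorm_sqr_unit x e1) addrC lerD2r.
apply: le_trans (IH (x - inner x e *: e) os); rewrite le_eqVlt; apply/orP; left.
apply/eqP; apply: eq_big_seq => d ds.
by rewrite innerBl innerZl es// mulr0 subr0.
Qed.

Lemma rnorm_oproj_le s x (M : R) : orthonormal_seq s ->
  (forall e, e \in s -> rnorm (inner x e) <= M) ->
  rnorm (oproj s x) <= (size s)%:R * M.
Proof.
rewrite /oproj; elim: s => [_ _|e s IH /= [e1 es os] xM].
  by rewrite big_nil rnorm0 mul0r.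
rewrite big_cons (le_trans (rnormD _ _))// -[(size s).+1]addn1 natrD mulrDl.
rewrite addrC lerD//; last by rewrite rnormZ e1 mulr1 mul1r xM// mem_head.
by apply: IH => // d ds; apply: xM; rewrite inE ds orbT.
Qed.

(** The Fréchet-Riesz theorem: the representing vector minimizes
    [|x|^2 - 2 Re (l x)], and minimizing families are Cauchy by the
    parallelogram law. *)
Lemma riesz (l : H -> R[i]) (M : R) :
  (forall (a : R[i]) x y, l (a *: x + y) = a * l x + l y) ->
  (forall x, rnorm (l x) <= M * rnorm x) ->
  exists z, forall x, l x = inner x z.
Proof.
move=> lin lM.
have lD x y : l (x + y) = l x + l y by rewrite -[x in LHS]scale1r lin mul1r.
have l0 : l 0 = 0 by apply: (@addIr _ (l 0)); rewrite -lD !add0r.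
have lZ a x : l (a *: x) = a * l x.
  by rewrite -[_ *: _ in LHS]addr0 lin l0 addr0.
pose J x : R := rnorm x ^+ 2 - 2 * complex.Re (l x).
have JM x : - M ^+ 2 <= J x.
  have := lM x; have := Re_le_rnorm (l x); rewrite /J.
  by move=> h1 h2; have := sqr_ge0 (rnorm x - M); nra.
pose m := inf (range J).
have hi : has_inf (range J).
  by split; [exists (J 0), 0|exists (- M ^+ 2) => _ [x _ <-]].
have mJ x : m <= J x by apply: inf_lbound; [exact: hi.2|exists x].
have Jm e : 0 < e -> exists x, J x < m + e.
  by move=> e0; have [_ [x _ <-] h] := inf_adherent e0 hi; exists x.
have Jpar x y : rnorm (x - y) ^+ 2 =
    2 * J x + 2 * J y - 4 * J ((2^-1 : R)%:C *: (x + y)).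
  rewrite /J lZ ReZ lD ReD rnormZ rnorm_real exprMn real_normK ?num_real//.
  by rewrite rnorm_sqrB rnorm_sqrD; field.
pose F := filter_from [set e : R | 0 < e] (fun e => [set x | J x < m + e]).
have FF : ProperFilter F.
  apply: filter_from_proper; last by move=> e /Jm.
  apply: filter_from_filter; first by exists 1; exact: ltr01.
  move=> e d e0 d0; exists (Num.min e d); first by rewrite /= lt_min e0.
  move=> x /= xm; split; apply: (lt_le_trans xm);
    by rewrite lerD2l ge_min lexx ?orbT.
have Fc : cvg F.
  apply: cauchy_cvg; apply/cauchyP => -[e b]; rewrite ltcE /=.
  move=> /andP[/eqP-> e0].
  have d0 : 0 < e ^+ 2 / 4 by rewrite divr_gt0 ?exprn_gt0.
  have [x xm] := Jm _ d0; exists x; exists (e ^+ 2 / 4) => // y /= ym.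
  rewrite -ball_normE /= rnormE ltcR.
  rewrite -(@ltr_pXn2r _ 2) ?nnegrE ?rnorm_ge0 ?(ltW e0)// Jpar.
  by have := mJ ((2^-1 : R)%:C *: (x + y)); lra.
pose z : H := lim F; have Fz : id @ F --> z by exact: Fc.
have M1 : 0 <= `|M| by [].
have Jz : J z <= m.
  apply/ler_addgt0Pr => e e0.
  have C0 : 0 < 2 * (rnorm z + `|M|) + 1.
    by have := rnorm_ge0 z; lra.
  have d0 : 0 < e / 2 / (2 * (rnorm z + `|M|) + 1).
    by rewrite divr_gt0// divr_gt0.
  have e2 : 0 < e / 2 by rewrite divr_gt0.
  have FJ : F [set x | J x < m + e / 2] by exists (e / 2).
  have [x [xm xz]] := @filter_ex _ F _ _ (filterI FJ (cvg_rnorm_lt Fz d0)).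
  move: xm xz; rewrite /= => xm; rewrite ltr_pdivlMr// => xz.
  have -> : J z = J x - rnorm (x - z) ^+ 2 - 2 * complex.Re (inner (x - z) z)
      + 2 * complex.Re (l (x - z)).
    have -> : J x = J (x - z + z) by rewrite subrK.
    by rewrite /J (rnorm_sqrD (x - z)) (lD (x - z)) ReD; ring.
  have := rnorm_ge_Re (inner (x - z) z).
  have := Re_le_rnorm (l (x - z)); have := lM (x - z).
  have := rnorm_inner (x - z) z.
  have := ler_norm (- complex.Re (inner (x - z) z)); rewrite normrN.
  have := ler_norm M; have := rnorm_ge0 (x - z).
  set r := rnorm (x - z) in xz *; have := sqr_ge0 r.
  by move=> *; nra.
have Re0 h : complex.Re (inner h z - l h) = 0.
  set c := complex.Re _.
  have cE (t : R) : 0 <= t ^+ 2 * rnorm h ^+ 2 + 2 * t * c.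
    have := mJ (z + t%:C *: h); rewrite {1}/J lD ReD lZ ReZ rnorm_sqrD rnormZ.
    rewrite rnorm_real exprMn real_normK ?num_real//.
    have -> : complex.Re (inner z (t%:C *: h)) = t * complex.Re (inner h z).
      by rewrite inner_conj ReJ innerZl ReZ.
    have -> : c = complex.Re (inner h z) - complex.Re (l h) by rewrite /c ReB.
    by move: Jz; rewrite /J; lra.
  have h1 : 0 < rnorm h ^+ 2 + 1 by have := sqr_ge0 (rnorm h); lra.
  (* a value of [t] at which the quadratic is negative unless [c] vanishes *)
  have := cE (- c / (rnorm h ^+ 2 + 1)); set N := rnorm h ^+ 2 in h1 *.
  have N0 : N + 1 != 0 by rewrite gt_eqF.
  have -> : (- c / (N + 1)) ^+ 2 * N + 2 * (- c / (N + 1)) * c =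
     - (c ^+ 2 * (N + 2)) / (N + 1) ^+ 2 by field.
  rewrite pmulr_lge0 ?invr_gt0 ?exprn_gt0//.
  rewrite oppr_ge0 pmulr_lle0 => [c0|]; last by rewrite /N; nra.
  by apply/eqP; rewrite -sqrf_eq0 eq_le c0 sqr_ge0.
exists z => h; apply/eqP; rewrite eq_sym -subr_eq0 eq_complex.
apply/andP; split.
  by rewrite Re0.
(* imaginary parts are real parts at the rotated vector *)
have := Re0 ('i%C *: h); rewrite innerZl lZ -mulrBr mulrC ReiNIm => /eqP.
by rewrite oppr_eq0.
Qed.

(** Weak compactness of balls, in the form of limits along ultrafilters: the
    coefficients converge, and their limit is represented by a vector. *)
Lemma weak_limit T (F : set_system T) (f : T -> H) (M : R) : UltraFilter F ->
  (\forall t \near F, rnorm (f t) <= M) ->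
  exists2 z, rnorm z <= M &
    forall x, (inner x (f t) : R[i]^o) @[t --> F] --> (inner x z : R[i]^o).
Proof.
move=> FU fM.
have M0 : 0 <= M.
  by have [t /(le_trans (rnorm_ge0 _))] := @filter_ex _ F _ _ fM.
have /choice [l lE] : forall x, exists a : R[i]^o,
    (inner x (f t) : R[i]^o) @[t --> F] --> a.
  move=> x; apply: (@ultra_cvg _ _ _ _ (rnorm x * M)).
  apply: filterS fM => t ft; apply: le_trans (rnorm_inner _ _) _.
  by rewrite ler_wpM2l// rnorm_ge0.
have [z zE] : exists z, forall x, l x = inner x z.
  apply: (@riesz _ M) => [a x y|x].
    apply: cvg_rnorm_unique (lE _) _; under eq_fun do rewrite innerDl innerZl.
    apply: (@cvgD _ R[i]^o); last exact: lE.
    by apply: (@cvgZr _ R[i]^o); exact: lE.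
  rewrite -[l x]subr0; apply: cvg_lim_rnorm (lE x) _.
  apply: filterS fM => t ft; rewrite subr0 (le_trans (rnorm_inner _ _))//.
  by rewrite mulrC ler_wpM2r// rnorm_ge0.
exists z => [|x]; last by rewrite -zE; exact: lE.
have [z0|z0] := eqVneq (rnorm z) 0; first by rewrite z0.
have {}z0 : 0 < rnorm z by rewrite lt_neqAle eq_sym z0 rnorm_ge0.
rewrite -(ler_pM2l z0) -expr2.
have -> : rnorm z ^+ 2 = rnorm (l z - 0).
  by rewrite subr0 zE innerE rnorm_real ger0_norm// sqr_ge0.
apply: cvg_lim_rnorm (lE z) _; apply: filterS fM => t ft.
rewrite subr0; apply: le_trans (rnorm_inner _ _) _.
by rewrite ler_wpM2l// ltW.
Qed.

End hilbert.

(** * Compactness of sets and of operators *)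

Lemma filter_seq X (F : set_system X) (I : eqType) (s : seq I)
    (P : I -> X -> Prop) : Filter F ->
  (forall i, i \in s -> \forall t \near F, P i t) ->
  \forall t \near F, forall i, i \in s -> P i t.
Proof.
move=> FF; elim: s => [_|i s IH h]; first by apply: nearW => t i.
have h1 := h i (mem_head _ _).
have h2 : \forall t \near F, forall i, i \in s -> P i t.
  by apply: IH => j js; apply: h; rewrite inE js orbT.
by apply: filterS2 h1 h2 => t h1 h2 j; rewrite inE => /orP[/eqP->//|/h2].
Qed.

Section compactness.
Variables (R : realType) (H : hilbertType R).
Implicit Types (x y z : H) (s : seq H).

Lemma precompact_net (A : set H) (e : R) : 0 < e -> precompact A ->
  exists s : seq H, forall x, A x -> exists2 c, c \in s & rnorm (x - c) < e.
Proof.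
move=> e0; rewrite precompactE compact_cover => /(_ H setT).
move=> /(_ (fun c => [set x | rnorm (c - x) < e])) [].
- move=> c _; rewrite openE => x /= cx.
  have d0 : 0 < (e - rnorm (c - x))%:C by rewrite ltcR subr_gt0.
  apply/nbhs_ballP; exists (e - rnorm (c - x))%:C => // y.
  rewrite -ball_normE /= rnormE ltcR => xy.
  rewrite -(subrKA x); apply: le_lt_trans (rnormD _ _) _.
  by rewrite addrC -ltrBrDr.
- by move=> x _; exists x => //=; rewrite subrr rnorm0.
- move=> D _ AD; exists (finmap.enum_fset D).
  move=> x /subset_closure /AD [c /= cD cx].
  by exists c => //; rewrite rnormBC.
Qed.

(** An ultrafilter on the closure of the image is pulled back to the domain, up
    to [e / 4], by choosing approximate preimages; then completeness applies. *)
Lemma precompact_image_ultra (f : H -> H) (D : set H) :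
  (forall F : set_system H, UltraFilter F -> F D -> forall e : R, 0 < e ->
    exists2 A, F A & forall a b, A a -> A b -> rnorm (f a - f b) <= e) ->
  precompact (f @` D).
Proof.
move=> fD; rewrite precompactE compact_ultra => G GU GC.
have rE (e : R) : 0 < e -> exists r : H -> H, forall y : H,
    closure (f @` D) y -> D (r y) /\ rnorm (y - f (r y)) < e.
  move=> e0; suff h : forall y : H, exists x : H,
    closure (f @` D) y -> D x /\ rnorm (y - f x) < e.
    by have [r] := choice h; exists r.
  move=> y; have [yD|] := pselect (closure (f @` D) y); last by exists 0.
  have [_ [[x Dx <-]]] : f @` D `&` ball y e%:C !=set0.
    by apply: yD; apply: nbhsx_ballx; rewrite ltcR.
  by rewrite -ball_normE /= rnormE ltcR => yx; exists x.
have Gc : cvg G.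
  apply: cauchy_cvg; apply/cauchyP => -[e b]; rewrite ltcE /=.
  move=> /andP[/eqP-> e0].
  have e4 : 0 < e / 4 by rewrite divr_gt0.
  have [r rP] := rE _ e4.
  have FU := ultra_fmap r GU.
  have [|A GA Ad] := fD _ FU _ _ e4.
    have : G (r @^-1` D) by apply: filterS GC => y /rP[]. by [].
  have {}GA : G (r @^-1` A) := GA.
  have GI : G (closure (f @` D) `&` r @^-1` A) by exact: filterI.
  have [p [pC pA]] := @filter_ex _ G _ _ GI.
  exists p; apply: filterS GI => y [yC yA]; rewrite -ball_normE /= rnormE ltcR.
  have -> : p - y = (p - f (r p)) + (f (r p) - f (r y)) - (y - f (r y)).
    by rewrite opprB !addrA !subrK.
  apply: le_lt_trans (rnormB _ _) _.
  have := rnormD (p - f (r p)) (f (r p) - f (r y)).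
  have := Ad _ _ pA yA; have [_] := rP _ pC; have [_] := rP _ yC.
  by move=> *; lra.
exists (lim G); split; last exact: Gc.
have /closure_id -> := @closed_closure _ (f @` D).
move=> B /Gc GB.
have : G (closure (f @` D) `&` B) by exact: filterI.
exact: filter_ex.
Qed.

(** An operator whose compressions to complements of suitable finite
    dimensional subspaces are arbitrarily small is compact: along an ultrafilter
    of the unit ball the finitely many coordinates converge, and only the small
    compression remains. *)
Lemma small_compression_compact (T : {linear H -> H}) : continuous T ->
  (forall e : R, 0 < e -> exists2 s, orthonormal_seq s & forall x y,
     perp x s -> perp y s -> rnorm (inner (T x) y) <= e * rnorm x * rnorm y) ->
  precompact (T @` [set x | `|x| <= 1]).
Proof.
move=> /continuous_linear_rnormP [M M0 TM] small.
apply: precompact_image_ultra => F FU FD e e0.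
have e4 : 0 < e / 4 by rewrite divr_gt0.
have [s os sT] := small _ e4.
have ball1 x : `|x| <= 1 -> rnorm x <= 1 by rewrite -rnorm_le.
pose n : R := (size s)%:R; have n0 : 0 <= n by rewrite ler0n.
pose d := e / (4 * (n * (1 + M)) + 1).
have C0 : 0 < 4 * (n * (1 + M)) + 1 by nra.
have d0 : 0 < d by rewrite divr_gt0.
have dE : 4 * (n * (1 + M)) * d <= e.
  by rewrite mulrC -[leRHS](divfK (lt0r_neq0 C0)) ler_wpM2l ?(ltW d0)// lerDl.
have [l lE] : exists l : H -> R[i], forall v, v \in s -> \forall x \near F,
    rnorm (inner x v - l v) < d.
  suff /choice[l lP] : forall v, exists a : R[i]^o,
      (inner x v : R[i]^o) @[x --> F] --> a.
    by exists l => v vs; exact: (cvg_rnorm_lt (lP v) d0).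
  move=> v; apply: (@ultra_cvg _ _ _ _ (rnorm v)); apply: filterS FD => x xD.
  apply: le_trans (rnorm_inner _ _) _; rewrite ler_piMl ?rnorm_ge0//.
  exact: ball1.
have [k kE] : exists k : H -> R[i], forall v, v \in s -> \forall x \near F,
    rnorm (inner (T x) v - k v) < d.
  suff /choice[k kP] : forall v, exists a : R[i]^o,
      (inner (T x) v : R[i]^o) @[x --> F] --> a.
    by exists k => v vs; exact: (cvg_rnorm_lt (kP v) d0).
  move=> v; apply: (@ultra_cvg _ _ _ _ (M * rnorm v)).
  apply: filterS FD => x xD.
  apply: le_trans (rnorm_inner _ _) _; rewrite ler_wpM2r ?rnorm_ge0//.
  by apply: le_trans (TM _) _; rewrite ler_piMr// ball1.
exists ([set x | `|x| <= 1] `&`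
    ([set x | forall v, v \in s -> rnorm (inner x v - l v) < d] `&`
     [set x | forall v, v \in s -> rnorm (inner (T x) v - k v) < d])).
  apply: filterI => //.
  by apply: filterI; [exact: filter_seq lE|exact: filter_seq kE].
move=> a b [a1 [la ka]] [b1 [lb kb]]; rewrite -linearB; set z := a - b.
have z2 : rnorm z <= 2.
  apply: le_trans (rnormB _ _) _.
  by rewrite (_ : 2 = 1 + 1)// lerD//; exact: ball1.
have zs v : v \in s -> rnorm (inner z v) <= 2 * d.
  move=> vs; have h1 := la _ vs; have h2 := lb _ vs.
  rewrite innerBl -(subrKA (l v)); apply: le_trans (rnormD _ _) _.
  by rewrite [rnorm (l v - _)]rnormBC; lra.
have Tzs v : v \in s -> rnorm (inner (T z) v) <= 2 * d.
  move=> vs; have h1 := ka _ vs; have h2 := kb _ vs.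
  rewrite linearB innerBl -(subrKA (k v)); apply: le_trans (rnormD _ _) _.
  by rewrite [rnorm (k v - _)]rnormBC; lra.
have := rnorm_oproj_le os zs; have := rnorm_oproj_le os Tzs; rewrite -/n.
have zp := sub_oproj_perp z os; have := sub_oproj_perp (T z) os.
set w := T z - oproj s (T z) => wp.
have w2 : rnorm w ^+ 2 <= (M * rnorm (oproj s z) + e / 4 * 2) * rnorm w.
  have -> : rnorm w ^+ 2 = rnorm (inner (T z) w).
    have -> : inner (T z) w = inner w w + inner (oproj s (T z)) w.
      by rewrite -innerDl subrK.
    by rewrite perp_oproj// addr0 innerE rnorm_real ger0_norm// sqr_ge0.
  have -> : T z = T (z - oproj s z) + T (oproj s z) by rewrite -linearD subrK.
  rewrite innerDl.
  apply: le_trans (rnormD _ _) _; rewrite addrC mulrDl; apply: lerD.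
    by apply: le_trans (rnorm_inner _ _) _; rewrite ler_wpM2r ?rnorm_ge0.
  apply: le_trans (sT _ _ zp wp) _; rewrite ler_wpM2r ?rnorm_ge0//.
  rewrite ler_wpM2l ?(ltW e4)//; exact: le_trans (rnorm_sub_oproj _ _) _.
have {}w2 : rnorm w <= M * rnorm (oproj s z) + e / 4 * 2.
  have [w0|w0] := eqVneq (rnorm w) 0.
    by rewrite w0 addr_ge0// mulr_ge0 ?rnorm_ge0// ltW.
  have {}w0 : 0 < rnorm w by rewrite lt_neqAle eq_sym w0 rnorm_ge0.
  by move: w2; rewrite expr2 ler_pM2r.
move=> h1 h2; rewrite -[T z](subrK (oproj s (T z))) -/w.
apply: le_trans (rnormD _ _) _.
have : M * rnorm (oproj s z) <= M * (n * (2 * d)) by rewrite ler_wpM2l.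
by move=> ?; nra.
Qed.

End compactness.

(** * Compact sesquilinear forms *)

Section forms.
Variables (R : realType) (H : hilbertType R).
Implicit Types (x y z : H) (s : seq H).

Definition sesquilinear (B : H -> H -> R[i]) : Prop :=
  (forall (a : R[i]) x x' y, B (a *: x + x') y = a * B x y + B x' y) /\
  (forall (a : R[i]) x y y', B x (a *: y + y') = Num.conj a * B x y + B x y').

(** Compactness of the operator representing a form, seen from its right
    argument. *)
Definition compact_form (B : H -> H -> R[i]) : Prop :=
  forall e : R, 0 < e -> exists2 s, orthonormal_seq s &
    forall x y, perp y s -> rnorm (B x y) <= e * rnorm x * rnorm y.

Section one_form.
Variables (B : H -> H -> R[i]) (C : R).
Hypothesis sB : sesquilinear B.
Hypothesis C_ge0 : 0 <= C.
Hypothesis BC : forall x y, rnorm (B x y) <= C * rnorm x * rnorm y.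

Lemma formDl x x' y : B (x + x') y = B x y + B x' y.
Proof. by have [h _] := sB; rewrite -[x in LHS]scale1r h mul1r. Qed.

Lemma formDr x y y' : B x (y + y') = B x y + B x y'.
Proof.
by have [_ h] := sB; rewrite -[y in LHS]scale1r h rmorph1 mul1r.
Qed.

Lemma form0l y : B 0 y = 0.
Proof. by apply: (@addIr _ (B 0 y)); rewrite -formDl !add0r. Qed.

Lemma form0r x : B x 0 = 0.
Proof. by apply: (@addIr _ (B x 0)); rewrite -formDr !add0r. Qed.

Lemma formZl a x y : B (a *: x) y = a * B x y.
Proof. by have [h _] := sB; rewrite -[a *: x]addr0 h form0l addr0. Qed.

Lemma formZr a x y : B x (a *: y) = Num.conj a * B x y.
Proof. by have [_ h] := sB; rewrite -[a *: y]addr0 h form0r addr0. Qed.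

Lemma rnorm_normalize (V : normedModType R[i]) (v : V) : rnorm v != 0 ->
  rnorm ((rnorm v)^-1%:C *: v) = 1.
Proof.
move=> v0; rewrite rnormZ rnorm_real ger0_norm ?invr_ge0 ?rnorm_ge0//.
exact: mulVf.
Qed.

(** If no orthonormal family captures [B] up to [e], one builds by recursion
    arbitrarily long families of pairs, orthonormal in the second component, on
    which [B] stays above [e]. *)
Lemma compact_form_of_sums :
  (forall e : R, 0 < e -> exists2 n : nat, (0 < n)%N &
    forall p : seq (H * H), size p = n ->
      orthonormal_seq [seq q.2 | q <- p] ->
      (forall q, q \in p -> rnorm q.1 = 1) ->
      \sum_(q <- p) rnorm (B q.1 q.2) <= n%:R * e) ->
  compact_form B.
Proof.
move=> sums e e0; apply: contrapT => nB.
have step s : orthonormal_seq s -> exists q : H * H,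
    [/\ perp q.2 s, rnorm q.1 = 1, rnorm q.2 = 1 & e < rnorm (B q.1 q.2)].
  move=> os; apply: contrapT => nq; apply: nB; exists s => // x y ys.
  have [x0|x0] := eqVneq (rnorm x) 0.
    by rewrite (rnorm0_eq0 x0) form0l !rnorm0 mulr0 mul0r.
  have [y0|y0] := eqVneq (rnorm y) 0.
    by rewrite (rnorm0_eq0 y0) form0r !rnorm0 mulr0.
  rewrite leNgt; apply/negP => Bxy; apply: nq.
  exists ((rnorm x)^-1%:C *: x, (rnorm y)^-1%:C *: y); split => /=.
  - by move=> v vs; rewrite innerZl ys// mulr0.
  - exact: rnorm_normalize.
  - exact: rnorm_normalize.
  - rewrite formZl formZr !rnormM rnorm_conj !rnorm_real.
    rewrite !ger0_norm ?invr_ge0 ?rnorm_ge0// mulrA.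
    have xp : 0 < rnorm x by rewrite lt_neqAle eq_sym x0 rnorm_ge0.
    have yp : 0 < rnorm y by rewrite lt_neqAle eq_sym y0 rnorm_ge0.
    by rewrite -invfM mulrC ltr_pdivlMr ?mulr_gt0// mulrA.
have long n : exists p : seq (H * H), [/\ size p = n,
    orthonormal_seq [seq q.2 | q <- p], forall q, q \in p -> rnorm q.1 = 1 &
    n%:R * e <= \sum_(q <- p) rnorm (B q.1 q.2) /\
    ((0 < n)%N -> n%:R * e < \sum_(q <- p) rnorm (B q.1 q.2))].
  elim: n => [|n [p [sp op p1 [pe _]]]].
    by exists [::]; split => //; rewrite big_nil mul0r.
  have [q [qp q1 q2 Bq]] := step _ op.
  have lt : n.+1%:R * e < \sum_(r <- q :: p) rnorm (B r.1 r.2).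
    by rewrite big_cons -add1n natrD mulrDl mul1r ltr_leD.
  exists (q :: p); split => //=; first by rewrite sp.
    by move=> r; rewrite inE => /orP[/eqP->//|/p1].
  by split=> //; exact: ltW.
have [n n0 small] := sums _ e0.
have [p [sp op p1 [_ /(_ n0)]]] := long n.
by rewrite ltNge small.
Qed.

(** Compact forms are jointly weakly continuous on balls: expanding around the
    limit, a weakly null right argument has small coordinates in the finite
    orthonormal family that captures [B], and the left argument enters linearly
    through a functional represented by a vector. *)
Lemma compact_form_cvg T (F : set_system T) (f g : T -> H) x y (M : R) :
  Filter F -> 0 <= M -> compact_form B ->
  (forall t, rnorm (f t) <= M) -> (forall t, rnorm (g t) <= M) ->
  rnorm y <= M ->
  (forall a, (inner a (f t) : R[i]^o) @[t --> F] --> (inner a x : R[i]^o)) ->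
  (forall a, (inner a (g t) : R[i]^o) @[t --> F] --> (inner a y : R[i]^o)) ->
  (B (f t) (g t) : R[i]^o) @[t --> F] --> (B x y : R[i]^o).
Proof.
move=> FF M0 cB fM gM yM fx gy.
have [b bE] : exists b, forall z, B z y = inner z b.
  apply: (@riesz _ _ _ (C * rnorm y)) => [a z z'|z]; first exact: sB.1.
  by rewrite mulrAC.
apply: (@cvg_rnorm_le _ R[i]^o) => e e0.
have d1 : 0 < e / (4 * M ^+ 2 + 1).
  by rewrite divr_gt0//; have := sqr_ge0 M; lra.
have [s os sB'] := cB _ d1.
pose n : R := (size s)%:R; have n0 : 0 <= n by rewrite ler0n.
have C0 : 0 < 4 * (C * M * n) + 1.
  by have : 0 <= C * M * n; [rewrite !mulr_ge0|lra].
pose d := e / (4 * (C * M * n) + 1); have d0 : 0 < d by rewrite divr_gt0.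
have dE : 4 * (C * M * n) * d <= e.
  by rewrite mulrC -[leRHS](divfK (lt0r_neq0 C0)) ler_wpM2l ?(ltW d0)// lerDl.
have dE1 : 4 * M ^+ 2 * (e / (4 * M ^+ 2 + 1)) <= e.
  have C1 : 0 < 4 * M ^+ 2 + 1 by have := sqr_ge0 M; lra.
  by rewrite mulrC -[leRHS](divfK (lt0r_neq0 C1)) ler_wpM2l ?(ltW d1)// lerDl.
have e4 : 0 < e / 4 by rewrite divr_gt0.
have h1 : \forall t \near F, rnorm (inner b (f t) - inner b x) < e / 4.
  exact: (cvg_rnorm_lt (fx b) e4).
have h2 : \forall t \near F, forall v, v \in s ->
    rnorm (inner v (g t) - inner v y) < d.
  by apply: filter_seq => v vs; exact: (cvg_rnorm_lt (gy v) d0).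
apply: filterS2 h1 h2 => t h1 h2.
set w := g t - y.
have wM : rnorm w <= 2 * M.
  by apply: le_trans (rnormB _ _) _; have := gM t; lra.
have ws v : v \in s -> rnorm (inner w v) <= d.
  by move=> vs; rewrite rnorm_innerC innerBr ltW// h2.
have Pw := rnorm_oproj_le os ws.
have -> : B (f t) (g t) - B x y =
    B (f t) (w - oproj s w) + B (f t) (oproj s w) + inner (f t - x) b.
  rewrite -formDr subrK innerBl -!bE /w.
  have -> : B (f t) (g t) = B (f t) (g t - y) + B (f t) y.
    by rewrite -formDr subrK.
  by rewrite addrA.
have := rnormD (B (f t) (w - oproj s w) + B (f t) (oproj s w))
  (inner (f t - x) b).
have := rnormD (B (f t) (w - oproj s w)) (B (f t) (oproj s w)).
have := sB' (f t) _ (sub_oproj_perp w os).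
have := BC (f t) (oproj s w).
rewrite rnorm_innerC innerBr.
have wM' : rnorm (w - oproj s w) <= 2 * M.
  exact: le_trans (rnorm_sub_oproj _ os) wM.
have q1 : C * rnorm (f t) * rnorm (oproj s w) <= C * M * (n * d).
  apply: ler_pM; rewrite ?mulr_ge0 ?rnorm_ge0//; exact: ler_wpM2l.
set d1' := e / _ in d1 dE1 *.
have q2 : d1' * rnorm (f t) * rnorm (w - oproj s w) <= d1' * M * (2 * M).
  apply: ler_pM => //; first by rewrite mulr_ge0 ?rnorm_ge0// ltW.
    exact: rnorm_ge0.
  by rewrite ler_wpM2l// ltW.
have q3 : d1' * M * (2 * M) <= e / 2 by lra.
have q4 : C * M * (n * d) <= e / 4 by lra.
move: h1; rewrite innerBl ![inner b _]inner_conj -rmorphB rnorm_conj => *.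
by lra.
Qed.

End one_form.

(** Uniformly over orthonormal families, the diagonal coefficients of a compact
    operator are small on average: up to [e / 2] the vectors [T a] are taken
    from a finite set, and Bessel's inequality bounds the coefficients of each
    vector of that set. *)
Lemma compact_op_sums (T : {linear H -> H}) :
  precompact (T @` [set x | `|x| <= 1]) ->
  forall e : R, 0 < e -> exists2 n : nat, (0 < n)%N &
    forall p : seq (H * H), size p = n ->
      orthonormal_seq [seq q.2 | q <- p] ->
      (forall q, q \in p -> rnorm q.1 = 1) ->
      \sum_(q <- p) rnorm (inner (T q.1) q.2) <= n%:R * e.
Proof.
move=> cT e e0.
have e2 : 0 < e / 2 by rewrite divr_gt0.
have [cs net] := precompact_net e2 cT.
pose r : R := (size cs)%:R; have r0 : 0 <= r by rewrite ler0n.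
(* [d] is the loss per centre of the net, and [n] absorbs the constant term *)
pose d := e / (4 * (r + 1)).
have d0 : 0 < d by rewrite divr_gt0// mulr_gt0//; lra.
have dE : r * d <= e / 4.
  have r1 : r + 1 != 0 by rewrite gt_eqF//; lra.
  have -> : e / 4 = (r + 1) * d by rewrite /d; field.
  by rewrite ler_wpM2r ?(ltW d0)// lerDl.
pose S := \sum_(c <- cs) rnorm c ^+ 2 / d.
have S0 : 0 <= S.
  by apply: sumr_ge0 => c _; rewrite divr_ge0 ?sqr_ge0// ltW.
pose n := (Num.truncn (S / (e / 4))).+1.
have nS : S <= n%:R * (e / 4).
  rewrite -ler_pdivrMr ?divr_gt0// ltW// /n.
  by apply: truncnS_gt.
exists n => // p sp op p1.
have bound q : q \in p -> rnorm (inner (T q.1) q.2) <=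
    e / 2 + \sum_(c <- cs) (d + rnorm (inner c q.2) ^+ 2 / d).
  move=> qp; have q2 : rnorm q.2 = 1.
    have : q.2 \in [seq q.2 | q <- p] by apply: map_f.
    elim: [seq q.2 | q <- p] op => [//|v s IH /= [v1 _ os]].
    by rewrite inE => /orP[/eqP->|/IH]; [|exact].
  have [|c cs_c cT'] := net (T q.1).
    by exists q.1 => //=; rewrite rnorm_le p1.
  rewrite -[T q.1](subrK c) innerDl; apply: le_trans (rnormD _ _) _.
  apply: lerD.
    apply: le_trans (rnorm_inner _ _) _; rewrite q2 mulr1; exact: ltW.
  have pos c' : 0 <= d + rnorm (inner c' q.2) ^+ 2 / d.
    by rewrite addr_ge0 ?(ltW d0)// divr_ge0 ?sqr_ge0 ?(ltW d0).
  rewrite (perm_big _ (perm_to_rem cs_c)) big_cons /=.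
  apply: le_trans (_ : _ <= d + rnorm (inner c q.2) ^+ 2 / d) _; last first.
    by rewrite lerDl sumr_ge0.
  (* [t <= d + t ^+ 2 / d] for all [t >= 0] *)
  set t := rnorm _; have t0 : 0 <= t by exact: rnorm_ge0.
  have [td|td] := leP t d.
    by apply: le_trans td _; rewrite lerDl divr_ge0 ?sqr_ge0// ltW.
  apply: le_trans (_ : _ <= t ^+ 2 / d) _; last by rewrite lerDr ltW.
  by rewrite ler_pdivlMr// expr2 ler_wpM2l// ltW.
apply: le_trans (_ : _ <= \sum_(q <- p)
   (e / 2 + \sum_(c <- cs) (d + rnorm (inner c q.2) ^+ 2 / d))) _.
  by rewrite big_seq [leRHS]big_seq; exact: ler_sum.
rewrite big_split /= exchange_big /=.
have sumc (x : R) : \sum_(q <- p) x = n%:R * x.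
  by rewrite big_const_seq count_predT sp iter_addr_0 mulr_natl.
rewrite sumc.
have : \sum_(c <- cs) \sum_(q <- p) (d + rnorm (inner c q.2) ^+ 2 / d) <=
    \sum_(c <- cs) (n%:R * d + rnorm c ^+ 2 / d).
  apply: ler_sum => c _; rewrite big_split /= sumc lerD2l.
  rewrite -mulr_suml ler_pM2r ?invr_gt0//.
  by have := bessel c op; rewrite big_map.
rewrite [X in _ <= X -> _]big_split /= -/S.
rewrite big_const_seq count_predT iter_addr_0 -mulr_natl -/r.
have : n%:R * (r * d) <= n%:R * (e / 4) by rewrite ler_wpM2l// ler0n.
by move=> *; lra.
Qed.

End forms.

(** * Weakly almost periodic functions and double limits *)

Section weak.
Variables (R : realType) (V : normedModType R[i]).

Lemma weak_cvgP T (F : set_system T) {FF : Filter F} (f : T -> V) (v : V) :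
  (f : T -> weak_topology V) @ F --> (v : weak_topology V) <->
  forall phi : dual V,
    (sval phi (f t) : R[i]^o) @[t --> F] --> (sval phi v : R[i]^o).
Proof.
split=> [fv phi|fv].
  exact: (cvg_comp _ _ fv (@initial_ptws_cvg _ _ _ (@dual_eval _ V) v phi)).
by apply: (@cvg_initial_ptws _ _ _ (@dual_eval _ V)) => phi; exact: fv.
Qed.

Lemma dual_of (l : V -> R[i]) (M : R) : 0 <= M ->
  (forall (a : R[i]) x y, l (a *: x + y) = a * l x + l y) ->
  (forall x, rnorm (l x) <= M * rnorm x) ->
  exists phi : dual V, forall x, sval phi x = l x.
Proof.
move=> M0 lin lM.
pose L : {linear V -> R[i]^o} :=
  HB.pack (l : V -> R[i]^o) (GRing.isLinear.Build R[i] V R[i]^o *:%R l lin).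
have cL : continuous L by apply/continuous_linear_rnormP; exists M.
by exists (exist _ L cL).
Qed.

End weak.

Section almost_periodic.
Variables (R : realType) (G : topGroupType).
Local Notation cbr := (cbr R G).

Lemma cbr_rnormP (f : cbr) (M : R) :
  rnorm f <= M <-> forall s, rnorm (f s : R[i]^o) <= M.
Proof.
rewrite -rnorm_le; split=> [/(cb_normP f _).1 h s|h].
  by rewrite -rnorm_le; exact: h.
by apply/(cb_normP f _).2 => s; rewrite [leLHS]rnormE lecR.
Qed.

Lemma cbr_rnorm_ge (f : cbr) s : rnorm (f s : R[i]^o) <= rnorm f.
Proof. by move: s; apply/cbr_rnormP. Qed.

Lemma dual_cbr_eval (s : G) :
  exists phi : dual cbr, forall f : cbr, sval phi f = f s.
Proof.
apply: (@dual_of R cbr (fun f : cbr => f s) 1) => // f.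
by rewrite mul1r; exact: cbr_rnorm_ge.
Qed.

(** Limits of evaluations along an ultrafilter are functionals: they play the
    role of the points of a compactification of the group. *)
Lemma dual_cbr_ultralimit T (F : set_system T) (s : T -> G) : UltraFilter F ->
  exists phi : dual cbr, forall f : cbr,
    (f (s t) : R[i]^o) @[t --> F] --> (sval phi f : R[i]^o).
Proof.
move=> FU.
have /choice[l lE] : forall f : cbr, exists a : R[i]^o,
    (f (s t) : R[i]^o) @[t --> F] --> a.
  move=> f; apply: (@ultra_cvg _ _ _ _ (rnorm f)); apply: nearW => t.
  exact: cbr_rnorm_ge.
have [|a x y|x|phi phiE] := @dual_of R cbr l 1; last first.
- by exists phi => f; rewrite phiE; exact: lE.
- rewrite mul1r -[l x]subr0; apply: cvg_lim_rnorm (lE x) _.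
  by apply: nearW => t; rewrite subr0; exact: cbr_rnorm_ge.
- apply: cvg_rnorm_unique (lE _) _.
  apply: (@cvgD _ R[i]^o _ _ _ (fun t => a * x (s t)) (fun t => y (s t))).
    by apply: (@cvgZr _ R[i]^o); exact: lE.
  exact: lE.
- exact: ler01.
Qed.

(** Evaluations separate functions, so that weakly compact sets are closed. *)
Lemma cbr_weak_hausdorff : hausdorff_space (weak_topology cbr).
Proof.
move=> p q; rewrite cluster_cvgE => -[F FF [Fq pF]].
apply/val_inj/val_inj/funext => s.
have [phi phiE] := dual_cbr_eval s.
have h (k : weak_topology cbr) : F --> k ->
    (sval phi x : R[i]^o) @[x --> F] --> (sval phi k : R[i]^o).
  by move=> Fk; exact: ((@weak_cvgP _ _ _ F _ id k).1 Fk phi).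
by have := cvg_rnorm_unique (h _ pF) (h _ Fq); rewrite !phiE; exact.
Qed.

Lemma weakly_precompact_sub (A K : set cbr) :
  compact (K : set (weak_topology cbr)) -> A `<=` K -> weakly_precompact A.
Proof.
move=> cK AK; apply: (@precompact_subset (weak_topology cbr) A K AK).
exact: compact_precompact cbr_weak_hausdorff cK.
Qed.

(** One half of Grothendieck's double limit criterion: a weak cluster point of
    the translates by [g n], paired with a cluster point of the evaluations at
    [s m], computes both iterated limits. *)
Lemma WAP_double_limit (f : G -> R[i]^o) (g s : nat -> G) (a b : nat -> R[i]) :
  WAP f ->
  (forall n m, (m < n)%N -> f (g n * s m)%g = a n) ->
  (forall n m, (n <= m)%N -> f (g n * s m)%g = b n) ->
  forall e : R, 0 < e -> exists n, rnorm (a n - b n) < e.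
Proof.
move=> [F <- [K FK [cK _]]] fa fb e e0.
have [U UU ooU] := ultra_nat.
have [phi phiE] := dual_cbr_ultralimit s UU.
pose k n := cbr_translate (g n)^-1%g F.
have kE n t : k n t = F (g n * t)%g by rewrite /= /left_translate invgK.
move: cK; rewrite compact_ultra.
move=> /(_ _ (ultra_fmap (k : nat -> weak_topology cbr) UU)) [].
  by apply: nearW => n; apply: FK; exists (g n)^-1%g.
move=> h [_ kh].
have {}kh : forall psi : dual cbr,
    (sval psi (k n) : R[i]^o) @[n --> U] --> (sval psi h : R[i]^o).
  exact: (@weak_cvgP _ _ _ U _ k h).1 kh.
have hs m : (a n : R[i]^o) @[n --> U] --> (h (s m) : R[i]^o).
  have [ev evE] := dual_cbr_eval (s m).
  have := kh ev; rewrite evE; apply: cvg_trans; apply: near_eq_cvg.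
  apply: ooU; exists m.+1 => // n /= mn.
  by rewrite evE kE fa.
have phik n : sval phi (k n) = b n.
  apply: cvg_rnorm_unique (phiE (k n)) _; apply: cvg_near_cst.
  by apply: ooU; exists n => // m nm; exact: etrans (kE n (s m)) (fb n m nm).
have phih : sval phi h = h (s 0%N).
  apply: cvg_rnorm_unique (phiE h) _; apply: cvg_near_cst.
  by apply: nearW => m; rewrite (cvg_rnorm_unique (hs m) (hs 0%N)).
have bh : (b n : R[i]^o) @[n --> U] --> (h (s 0%N) : R[i]^o).
  by rewrite -phih; have := kh phi; under eq_fun do rewrite phik.
have e2 : 0 < e / 2 by rewrite divr_gt0.
have h1 : \forall n \near U, rnorm (a n - h (s 0%N)) < e / 2.
  exact: (cvg_rnorm_lt (hs 0%N) e2).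
have h2 : \forall n \near U, rnorm (b n - h (s 0%N)) < e / 2.
  exact: (cvg_rnorm_lt bh e2).
have [n [n1 n2]] := @filter_ex _ U _ _ (filterI h1 h2).
exists n; rewrite -(subrKA (h (s 0%N))); apply: le_lt_trans (rnormD _ _) _.
by rewrite [rnorm (h _ - _)]rnormBC [e]splitr ltrD.
Qed.

End almost_periodic.

(** * Compact operators plus scalars have almost periodic coefficients *)

Lemma cbr_ext (R : realType) (G : topGroupType) (f h : cbr R G) :
  (forall s, f s = h s) -> f = h.
Proof. by move=> fh; apply/val_inj/val_inj/funext. Qed.

Lemma cbr_cst (R : realType) (G : topGroupType) (c : R[i]) :
  exists f : cbr R G, forall s, f s = c.
Proof.
have cP : (fun _ : G => c : R[i]^o) \in @cb_pred R G.
  apply/asboolP; split; first exact: cst_continuous.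
  by apply/bounded_setTP; exists `|c|.
have rP : Cb cP \in @cbr_pred R G.
  apply/asboolP/right_uniformly_continuousP.
  have -> : (fun g => cb_translate g (Cb cP)) = cst (Cb cP).
    by apply/funext => g; exact: val_inj.
  exact: cvg_cst.
by exists (Cbr rP).
Qed.

Section coefficients.
Variables (R : realType) (H : hilbertType R).
Implicit Types (x y z : H) (T K : {linear H -> H}).
Local Notation cbr := (cbr R (unitary H)).

Lemma orbit_coefE x y T (u : unitary H) :
  orbit_coef x y T u = inner (T (adjoint u x)) (adjoint u y).
Proof. exact: adjointE. Qed.

Lemma rnorm_unitary (u : unitary H) x : rnorm (u x) = rnorm x.
Proof. by rewrite /rnorm norm_unitary. Qed.

Lemma rnorm_adjoint (u : unitary H) x : rnorm (adjoint u x) = rnorm x.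
Proof. exact: (rnorm_unitary (unitary_inv u)). Qed.

Lemma inner_adjoint (u : unitary H) x y :
  inner (adjoint u x) (adjoint u y) = inner x y.
Proof. by rewrite -adjointE adjointVK. Qed.

Lemma near_unitary (u : unitary H) x (e : R) : 0 < e ->
  \forall v \near nbhs u, rnorm ((v : unitary H) x - u x) < e.
Proof.
have FF := nbhs_filter u; apply: (@cvg_rnorm_lt _ _ _ _ FF).
exact: (@unitary_cvg_strong R H _ _ id u FF cvg_id x).
Qed.

Lemma near_adjoint (u : unitary H) x (e : R) : 0 < e ->
  \forall v \near nbhs u, rnorm (adjoint (v : unitary H) x - adjoint u x) < e.
Proof.
have FF := nbhs_filter u; apply: (@cvg_rnorm_lt _ _ _ _ FF).
apply: (@unitary_cvg_strong R H _ _ (fun v => v^-1)%g u^-1%g FF _ x).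
exact: (@invg_continuous (unitary H) u).
Qed.

Lemma rnorm_form_sub T (M : R) x x' y y' : 0 <= M ->
  (forall z, rnorm (T z) <= M * rnorm z) ->
  rnorm (inner (T x) y - inner (T x') y') <=
    M * (rnorm (x - x') * rnorm y + rnorm x' * rnorm (y - y')).
Proof.
move=> M0 TM.
have -> : inner (T x) y - inner (T x') y' =
    inner (T (x - x')) y + inner (T x') (y - y').
  by rewrite linearB innerBl innerBr addrA subrK.
apply: le_trans (rnormD _ _) _; rewrite mulrDr !mulrA.
apply: lerD; apply: le_trans (rnorm_inner _ _) _;
  by rewrite ler_wpM2r ?rnorm_ge0.
Qed.

(** Coefficients of every bounded operator are right uniformly continuous,
    because the weak operator topology is the strong one on unitaries. *)
Lemma orbit_coef_cbr T : continuous T ->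
  exists f : H -> H -> cbr, forall x y u, f x y u = orbit_coef x y T u.
Proof.
move=> /continuous_linear_rnormP [M M0 TM].
suff h : forall q : H * H, exists f : cbr,
    forall u, f u = orbit_coef q.1 q.2 T u.
  have [f fE] := choice h; exists (fun x y => f (x, y)) => x y u.
  exact: fE (x, y) u.
move=> [x y] /=.
have bnd u : rnorm (orbit_coef x y T u : R[i]^o) <= M * rnorm x * rnorm y.
  rewrite orbit_coefE; apply: le_trans (rnorm_inner _ _) _.
  rewrite rnorm_adjoint ler_wpM2r ?rnorm_ge0//.
  by apply: le_trans (TM _) _; rewrite rnorm_adjoint.
pose C := M * (rnorm x + rnorm y) + 1.
have C0 : 0 < C.
  by have := rnorm_ge0 x; have := rnorm_ge0 y; rewrite /C => *; nra.
have small (a b r : R) : 0 <= r -> a <= r -> b <= r ->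
    M * (a * rnorm y + rnorm x * b) <= C * r.
  move=> r0 ar br; have := rnorm_ge0 x; have := rnorm_ge0 y => *.
  apply: le_trans (_ : _ <= M * (r * rnorm y + rnorm x * r)) _.
    by rewrite ler_wpM2l// lerD// ?ler_wpM2r// ler_wpM2l.
  by rewrite /C; nra.
have cf : continuous (orbit_coef x y T : unitary H -> R[i]^o).
  move=> u; apply: (@cvg_rnorm_le _ R[i]^o _ _ (nbhs_filter u)) => e e0.
  have d0 : 0 < e / C by rewrite divr_gt0.
  apply: filterS2 (near_adjoint u x d0) (near_adjoint u y d0) => v vx vy.
  rewrite !orbit_coefE.
  apply: le_trans (rnorm_form_sub _ _ _ _ M0 TM) _.
  rewrite !rnorm_adjoint [leRHS](_ : e = C * (e / C)); last first.
    by rewrite mulrC divfK ?lt0r_neq0.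
  by apply: small; exact: ltW.
have cP : (orbit_coef x y T : unitary H -> R[i]^o) \in @cb_pred R (unitary H).
  apply/asboolP; split => //; apply/bounded_setTP.
  by exists (M * rnorm x * rnorm y)%:C => u; rewrite rnorm_le.
have rP : Cb cP \in @cbr_pred R (unitary H).
  apply/asboolP/right_uniformly_continuousP.
  apply: (@cvg_rnorm_le _ _ _ _ (nbhs_filter (1%g : unitary H))) => e e0.
  have d0 : 0 < e / C by rewrite divr_gt0.
  apply: filterS2 (near_unitary 1%g x d0) (near_unitary 1%g y d0) => g gx gy.
  rewrite -rnorm_le.
  apply/cb_normP => u; rewrite [leLHS]rnormE lecR.
  rewrite [X in rnorm X](_ : _ = inner (T (adjoint u (g x))) (adjoint u (g y)) -
    inner (T (adjoint u x)) (adjoint u y)); last first.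
    by congr (_ - _); exact: orbit_coefE.
  apply: le_trans (rnorm_form_sub _ _ _ _ M0 TM) _.
  rewrite -!linearB !rnorm_adjoint rnorm_unitary.
  rewrite [leRHS](_ : e = C * (e / C)); last by rewrite mulrC divfK ?lt0r_neq0.
  by apply: small; exact: ltW.
by exists (Cbr rP).
Qed.

Lemma left_translate_orbit_coef (g u : unitary H) x y T :
  left_translate g (orbit_coef x y T) u = orbit_coef (g x) (g y) T u.
Proof. by rewrite /left_translate !orbit_coefE. Qed.

Lemma orthonormal_seq_adjoint (u : unitary H) s :
  orthonormal_seq s -> orthonormal_seq (map (adjoint u) s).
Proof.
elim: s => //= e s IH [e1 es /IH os]; split => //.
  by rewrite rnorm_adjoint.
by move=> _ /mapP[d ds ->]; rewrite inner_adjoint es.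
Qed.

(** The reason why coefficients of a compact operator are weakly almost
    periodic: a functional [phi] turns them into a form whose diagonal sums over
    an orthonormal family are values of [phi] at combinations of coefficients
    with weights of modulus at most one. As unitaries preserve orthonormality,
    [compact_op_sums] bounds the supremum norm of such a combination. *)
Lemma compact_form_functional K (f : H -> H -> cbr) (phi : dual cbr) :
  continuous K -> precompact (K @` [set x | `|x| <= 1]) ->
  (forall x y u, f x y u = orbit_coef x y K u) ->
  let B x y : R[i] := sval phi (f x y) in
  [/\ sesquilinear B, compact_form B &
    exists2 C : R, 0 <= C &
      forall x y, rnorm (B x y) <= C * rnorm x * rnorm y].
Proof.
move=> /continuous_linear_rnormP [M M0 KM] cK fE B.
have sB : sesquilinear B.
  split=> [a x x' y|a x y y']; rewrite /B.
    rewrite -[RHS](linearP (sval phi)); congr (sval phi _); apply: cbr_ext => u.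
    rewrite [RHS](_ : _ = a * f x y u + f x' y u)// !fE !orbit_coefE.
    by rewrite !linearP innerDl innerZl.
  rewrite -[RHS](linearP (sval phi)); congr (sval phi _); apply: cbr_ext => u.
  rewrite [RHS](_ : _ = Num.conj a * f x y u + f x y' u)// !fE !orbit_coefE.
  by rewrite linearP innerDr innerZr.
have [C C0 phiC] := (continuous_linear_rnormP (sval phi)).1 (svalP phi).
split=> //; last first.
  exists (C * M) => [|x y]; first exact: mulr_ge0.
  apply: le_trans (phiC _) _; rewrite -!mulrA ler_wpM2l//.
  apply/cbr_rnormP => u; rewrite fE orbit_coefE.
  apply: le_trans (rnorm_inner _ _) _.
  rewrite mulrA rnorm_adjoint ler_wpM2r ?rnorm_ge0//.
  by apply: le_trans (KM _) _; rewrite rnorm_adjoint.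
apply: compact_form_of_sums => // e e0.
have d0 : 0 < e / (C + 1) by rewrite divr_gt0// ltr_wpDl.
have [n n0 sums] := compact_op_sums cK d0; exists n => // p sp op p1.
have [th thP] : exists th : H * H -> R[i], forall q, rnorm (th q) <= 1 /\
    th q * B q.1 q.2 = (rnorm (B q.1 q.2))%:C.
  suff h : forall q : H * H, exists a : R[i], rnorm a <= 1 /\
      a * B q.1 q.2 = (rnorm (B q.1 q.2))%:C.
    by have [th thP] := choice h; exists th.
  move=> q; set b := B _ _.
  have [b0|b0] := eqVneq (rnorm b) 0.
    by exists 0; rewrite rnorm0 mul0r b0 ler01.
  (* the phase that rotates [b] onto its absolute value *)
  exists ((rnorm b)^-1%:C * Num.conj b).
  rewrite rnormM rnorm_conj rnorm_real ger0_norm ?invr_ge0 ?rnorm_ge0//.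
  rewrite mulVf//; split=> //; rewrite -mulrA [_ * b]mulrC -normCK rnormE.
  by rewrite -rmorphXn -rmorphM /= expr2 mulrA mulVf// mul1r.
have bound : rnorm (\sum_(q <- p) th q *: f q.1 q.2) <= n%:R * (e / (C + 1)).
  apply/cbr_rnormP => u.
  have -> : (\sum_(q <- p) th q *: f q.1 q.2 : cbr) u =
      \sum_(q <- p) th q * inner (K (adjoint u q.1)) (adjoint u q.2).
    elim: (p) => [|q s IH]; first by rewrite !big_nil.
    rewrite !big_cons -IH -orbit_coefE -fE //.
  apply: le_trans (rnorm_sum _ _) _.
  have := sums [seq (adjoint u q.1, adjoint u q.2) | q <- p].
  rewrite size_map sp => /(_ erefl).
  rewrite -map_comp (@eq_map _ _ _ (adjoint u \o snd))// map_comp.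
  move=> /(_ (orthonormal_seq_adjoint u op)); rewrite big_map /=.
  move=> h; apply: le_trans (h _) => [|_ /mapP[q qp ->] /=]; last first.
    by rewrite rnorm_adjoint p1.
  apply: ler_sum => q _; rewrite rnormM ler_piMl ?rnorm_ge0//.
  by have [] := thP q.
have -> : \sum_(q <- p) rnorm (B q.1 q.2) =
    rnorm (sval phi (\sum_(q <- p) th q *: f q.1 q.2) : R[i]).
  rewrite linear_sum.
  have -> : \sum_(q <- p) sval phi (th q *: f q.1 q.2) =
      (\sum_(q <- p) rnorm (B q.1 q.2))%:C.
    rewrite rmorph_sum; apply: eq_bigr => q _; rewrite linearZ.
    by have [] := thP q.
  by rewrite rnorm_real ger0_norm// sumr_ge0// => q _; exact: rnorm_ge0.
apply: le_trans (phiC _) _; apply: le_trans (ler_wpM2l C0 bound) _.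
rewrite mulrCA ler_wpM2l ?ler0n// mulrCA ler_piMr ?(ltW e0)//.
by rewrite ler_pdivrMr ?mul1r ?lerDl// ltr_wpDl.
Qed.

(** The scalar part only adds the constant [c * inner xi eta] to the
    coefficient, as unitaries preserve inner products. The translates of the
    remaining part are coefficients at vectors of a ball, and this larger set of
    coefficients is weakly compact, by weak compactness of the ball and weak
    continuity of the forms attached to functionals. *)
Lemma compact_add_scalar_wap K (c : R[i]) (T : {linear H -> H}) :
  continuous K -> precompact (K @` [set x | `|x| <= 1]) ->
  (forall x, T x = K x + c *: x) ->
  forall xi eta, WAP (orbit_coef xi eta T).
Proof.
move=> cK pK TE xi eta.
have [f fE] := orbit_coef_cbr cK.
have [k kE] := @cbr_cst R (unitary H) (c * inner xi eta).
exists (f xi eta + k).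
  apply/funext => u; rewrite [LHS](_ : _ = f xi eta u + k u)//.
  rewrite kE fE !orbit_coefE.
  by rewrite TE innerDl innerZl inner_adjoint.
pose M := Num.max (rnorm xi) (rnorm eta).
have M0 : 0 <= M by rewrite le_max rnorm_ge0.
pose D := [set h : cbr | exists q : H * H,
  [/\ rnorm q.1 <= M, rnorm q.2 <= M & h = f q.1 q.2 + k]].
apply: (@weakly_precompact_sub _ _ _ D); last first.
  move=> _ [g _ <-]; exists (g xi, g eta); split => /=.
  - by rewrite rnorm_unitary le_max lexx.
  - by rewrite rnorm_unitary le_max lexx orbT.
  - apply: cbr_ext => u.
    rewrite [LHS](_ : _ =
      left_translate g (f xi eta) u + left_translate g k u)//.
    rewrite [RHS](_ : _ = f (g xi) (g eta) u + k u)//; congr (_ + _).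
      by rewrite fE -left_translate_orbit_coef /left_translate fE.
    by rewrite /left_translate !kE.
rewrite compact_ultra => W WU WD.
have [r rP] : exists r : cbr -> H * H, forall h, [/\ rnorm (r h).1 <= M,
    rnorm (r h).2 <= M & D h -> h = f (r h).1 (r h).2 + k].
  suff e : forall h : cbr, exists q : H * H, [/\ rnorm q.1 <= M,
      rnorm q.2 <= M & D h -> h = f q.1 q.2 + k].
    by have [r rP] := choice e; exists r.
  move=> h; have [[q [q1 q2 qE]]|nD] := pselect (D h); first by exists q.
  by exists (0, 0); rewrite /= rnorm0; split.
have [x xM xE] : exists2 x, rnorm x <= M & forall a,
    (inner a (r h).1 : R[i]^o) @[h --> W] --> (inner a x : R[i]^o).
  by apply: weak_limit; apply: nearW => h; have [] := rP h.
have [y yM yE] : exists2 y, rnorm y <= M & forall a,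
    (inner a (r h).2 : R[i]^o) @[h --> W] --> (inner a y : R[i]^o).
  by apply: weak_limit; apply: nearW => h; have [] := rP h.
exists (f x y + k); split; first by exists (x, y).
apply/(@weak_cvgP _ _ _ W _ id) => phi.
have [sB cB [C C0 BC]] := compact_form_functional phi cK pK fE.
have Bc : (sval phi (f (r h).1 (r h).2) : R[i]^o) @[h --> W] -->
    (sval phi (f x y) : R[i]^o).
  by apply: (compact_form_cvg sB C0 BC _ M0 cB _ _ yM xE yE) => h;
    have [] := rP h.
rewrite linearD; apply: cvg_trans (cvgD Bc (cvg_cst (sval phi k : R[i]^o))).
apply: near_eq_cvg; apply: filterS WD => h Dh /=.
by have [_ _ /(_ Dh) {2}->] := rP h; rewrite linearD.
Qed.

End coefficients.

(** * Operators with almost periodic coefficients *)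

Section converse.
Variables (R : realType) (H : hilbertType R).
Implicit Types (x y z : H) (s : seq H) (T : {linear H -> H}).

Lemma gram_schmidt s : exists2 s', orthonormal_seq s' &
  forall x, perp x s' -> perp x s.
Proof.
elim: s => [|v s [s' os' ss']]; first by exists [::].
pose w := v - oproj s' v.
have wp : perp w s' by exact: sub_oproj_perp.
have vE x : perp x s' -> inner x w = 0 -> perp x (v :: s).
  move=> xs' xw; apply/perp_cons; split; last exact: ss'.
  rewrite -[v](subrK (oproj s' v)) innerDr xw add0r.
  by apply: inner_eq0_sym; exact: perp_oproj.
have [w0|w0] := eqVneq (rnorm w) 0.
  exists s' => // x xs'; apply: vE => //.
  by rewrite (rnorm0_eq0 w0); exact: linear0r.
exists ((rnorm w)^-1%:C *: w :: s') => /=.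
  split => //; first exact: rnorm_normalize.
  by move=> d ds; rewrite innerZl wp// mulr0.
move=> x /perp_cons[xw xs']; apply: vE => //; apply/eqP.
move: xw => /eqP; rewrite innerZr mulf_eq0 conjC_eq0 => /orP[|//].
by rewrite (_ : 0 = 0%:C)// (inj_eq (@complexI _)) invr_eq0 (negbTE w0).
Qed.

(** The reflection in the hyperplane orthogonal to [v], which is normalized by
    [inner v v = 2] so that differences of orthonormal vectors qualify. *)
Lemma exists_reflection (v : H) : inner v v = 2 ->
  exists u : unitary H, forall x, adjoint u x = x - inner x v *: v.
Proof.
move=> v2; pose r x := x - inner x v *: v.
have lr : linear r.
  move=> a x y; rewrite /r innerDl innerZl scalerDl scalerBr scalerA.
  by rewrite opprD addrACA.
pose L : {linear H -> H} := HB.pack r (GRing.isLinear.Build R[i] H H *:%R r lr).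
have LE x y : inner (L x) y = inner x (L y).
  rewrite /= /r innerBl innerBr innerZl innerZr.
  by rewrite -inner_conj mulrC.
have LK : cancel L L.
  move=> x; rewrite /= /r innerBl innerZl v2 -[x in RHS]addr0 -addrA.
  congr (_ + _); rewrite -opprD -scalerDl.
  rewrite (_ : inner x v + (inner x v - inner x v * 2) = 0) ?scale0r ?oppr0//.
  by ring.
by exists (Unitary LE LK LK).
Qed.

Lemma exists_swap x y : rnorm x = 1 -> rnorm y = 1 ->
    inner x y = 0 \/ x = y ->
  exists2 u : unitary H, adjoint u x = y &
    forall z, inner z x = 0 -> inner z y = 0 -> adjoint u z = z.
Proof.
move=> x1 y1 [xy|<-]; last by exists (unitary1 H).
have yx := inner_eq0_sym xy.
have xx : inner x x = 1 by rewrite innerE x1 expr1n.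
have yy : inner y y = 1 by rewrite innerE y1 expr1n.
have [|u uE] := @exists_reflection (x - y).
  by rewrite innerBl !innerBr xx yy xy yx; ring.
exists u => [|z zx zy]; rewrite uE innerBr.
  by rewrite xx xy subr0 scale1r opprB addrC subrK.
by rewrite zx zy subrr scale0r subr0.
Qed.

Lemma adjointM (u v : unitary H) x :
  adjoint (u * v)%g x = adjoint v (adjoint u x).
Proof. by []. Qed.

Section swaps.
Variables e d : nat -> H.
Hypotheses (e1 : forall n, rnorm (e n) = 1) (d1 : forall n, rnorm (d n) = 1).
Hypothesis ee : forall n m, n != m -> inner (e n) (e m) = 0.
Hypothesis dd : forall n m, n != m -> inner (d n) (d m) = 0.
Hypothesis ed : forall n m, inner (e n) (d m) = 0.

(** Swapping [e n] with [d n] for [n <= m] is a finite product of reflections,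
    so it leaves the later vectors of both sequences in place. *)
Lemma exists_swaps : exists s : nat -> unitary H, forall n m,
  adjoint (s m) (e n) = if (n <= m)%N then d n else e n.
Proof.
have de n m : inner (d n) (e m) = 0 by exact: inner_eq0_sym.
have h n : exists u : unitary H, adjoint u (e n) = d n /\
    forall z, inner z (e n) = 0 -> inner z (d n) = 0 -> adjoint u z = z.
  by have [|u] := exists_swap (e1 n) (d1 n); [left|exists u].
have [w wP] := choice h.
exists (fix s m := if m is k.+1 then (s k * w k.+1)%g else w 0%N) => n m.
elim: m => [|m IH].
  have [we wz] := wP 0%N; rewrite leqn0; have [->//|n0] := eqVneq n 0%N.
  by rewrite wz// ee.
have [we wz] := wP m.+1; rewrite adjointM IH.
have [nm|mn] := leqP n m.
  by rewrite (leq_trans nm)// wz// dd// neq_ltn ltnS nm.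
have [->|nm] := eqVneq n m.+1; first by rewrite leqnn.
by rewrite leqNgt ltn_neqAle eq_sym nm mn /= wz// ee.
Qed.

(** If the adjoint of [g n] carries [e 0] to [e n], the coefficient at [e 0]
    takes the value [inner (T (d n)) (d n)] or [inner (T (e n)) (e n)] at
    [g n * s m], according to whether [n <= m]: the two iterated limits are the
    limits of the two diagonals. *)
Lemma wap_op_swaps T : (forall xi eta, WAP (orbit_coef xi eta T)) ->
  forall eps : R, 0 < eps -> exists n,
    rnorm (inner (T (e n)) (e n) - inner (T (d n)) (d n)) < eps.
Proof.
move=> wT; have [s sE] := exists_swaps.
have h n : exists u : unitary H, adjoint u (e 0%N) = e n.
  have [|u uE _] := exists_swap (e1 0%N) (e1 n); last by exists u.
  by have [->|n0] := eqVneq n 0%N; [right|left; rewrite ee// eq_sym].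
have [g gP] := choice h.
have gsE n m : orbit_coef (e 0%N) (e 0%N) T (g n * s m)%g =
    let x := if (n <= m)%N then d n else e n in inner (T x) x.
  by rewrite orbit_coefE adjointM gP sE.
apply: (WAP_double_limit (wT (e 0%N) (e 0%N)) (g := g) (s := s)
  (a := fun n => inner (T (e n)) (e n))
  (b := fun n => inner (T (d n)) (d n))) => n m nm.
  by apply: etrans (gsE n m) _; rewrite leqNgt nm.
by apply: etrans (gsE n m) _; rewrite nm.
Qed.

End swaps.

(** Were this false, vectors with distant diagonal values would exist
    orthogonally to any finite set, and the sequences excluded by [wap_op_swaps]
    could be built recursively. *)
Lemma wap_op_diagonal T : (forall xi eta, WAP (orbit_coef xi eta T)) ->
  forall eps : R, 0 < eps -> exists s, forall x y, perp x s -> perp y s ->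
    rnorm x = 1 -> rnorm y = 1 -> inner x y = 0 ->
    rnorm (inner (T x) x - inner (T y) y) < eps.
Proof.
move=> wT eps eps0; apply: contrapT => nT.
have [q qP] : exists q : seq H -> H * H, forall s, [/\ perp (q s).1 s,
    perp (q s).2 s, rnorm (q s).1 = 1 /\ rnorm (q s).2 = 1,
    inner (q s).1 (q s).2 = 0 &
    eps <= rnorm (inner (T (q s).1) (q s).1 - inner (T (q s).2) (q s).2)].
  suff h : forall s, exists q : H * H, [/\ perp q.1 s, perp q.2 s,
      rnorm q.1 = 1 /\ rnorm q.2 = 1, inner q.1 q.2 = 0 &
      eps <= rnorm (inner (T q.1) q.1 - inner (T q.2) q.2)].
    by have [q qP] := choice h; exists q.
  move=> s; apply: contrapT => nq; apply: nT; exists s => x y xs ys x1 y1 xy.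
  by rewrite ltNge; apply/negP => Txy; apply: nq; exists (x, y).
pose L := fix L n := if n is k.+1 then (q (L k)).1 :: (q (L k)).2 :: L k
                     else [::].
pose e n := (q (L n)).1; pose d n := (q (L n)).2.
have eL n m : (n < m)%N -> e n \in L m.
  elim: m => // m IH; rewrite ltnS leq_eqVlt !inE => /orP[/eqP->|/IH->].
    by rewrite eqxx.
  by rewrite !orbT.
have dL n m : (n < m)%N -> d n \in L m.
  elim: m => // m IH; rewrite ltnS leq_eqVlt !inE => /orP[/eqP->|/IH->].
    by rewrite eqxx orbT.
  by rewrite !orbT.
have orth (f : nat -> H) : (forall n, perp (f n) (L n)) ->
    (forall n m, (n < m)%N -> f n \in L m) ->
    forall n m, n != m -> inner (f n) (f m) = 0.
  move=> fp fL n m; rewrite neq_ltn => /orP[nm|mn]; last exact/fp/fL.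
  by apply: inner_eq0_sym; exact/fp/fL.
have [n] : exists n,
    rnorm (inner (T (e n)) (e n) - inner (T (d n)) (d n)) < eps.
  apply: wap_op_swaps => // [n|n|n m nm|n m nm|n m].
  - by have [_ _ []] := qP (L n).
  - by have [_ _ []] := qP (L n).
  - by apply: orth nm => // k; have [] := qP (L k).
  - by apply: orth nm => // k; have [] := qP (L k).
  - have [nm|mn|<-] := ltngtP n m.
    + by apply: inner_eq0_sym; have [_ h _ _ _] := qP (L m); exact/h/eL.
    + by have [h _ _ _ _] := qP (L n); exact/h/dL.
    + by have [] := qP (L n).
by rewrite ltNge; have [_ _ _ _ ->] := qP (L n).
Qed.

(** The essential numerical range is a single point: the diagonal of [T] is
    Cauchy along the filter of unit vectors orthogonal to finite sets, two such
    vectors being compared through a third one orthogonal to both. When this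
    filter is improper, the space is finite dimensional and every scalar will
    do. *)
Lemma diagonal_limit T (M : R) : 0 <= M ->
  (forall x, rnorm (T x) <= M * rnorm x) ->
  (forall eps : R, 0 < eps -> exists s, forall x y, perp x s -> perp y s ->
    rnorm x = 1 -> rnorm y = 1 -> inner x y = 0 ->
    rnorm (inner (T x) x - inner (T y) y) < eps) ->
  exists c : R[i], forall eps : R, 0 < eps -> exists s,
    forall x, perp x s -> rnorm x = 1 -> rnorm (inner (T x) x - c) <= eps.
Proof.
move=> M0 TM diag.
have [[s s0]|inf] :=
    pselect (exists s, forall x, perp x s -> rnorm x = 1 -> False).
  by exists 0 => eps _; exists s => x xs x1; case: (s0 x).
have {}inf s : exists x, perp x s /\ rnorm x = 1.
  apply: contrapT => nx; apply: inf; exists s => x xs x1; apply: nx.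
  by exists x.
have perp_cat x s1 s2 : perp x (s1 ++ s2) <-> perp x s1 /\ perp x s2.
  split=> [h|[h1 h2] y]; last by rewrite mem_cat => /orP[/h1|/h2].
  by split=> y ys; apply: h; rewrite mem_cat ys ?orbT.
pose F := filter_from [set: seq H] (fun s => [set x | perp x s /\ rnorm x = 1]).
have FF : ProperFilter F.
  apply: filter_from_proper => [|s _]; last exact: inf.
  apply: filter_from_filter; first by exists [::].
  move=> s1 s2 _ _; exists (s1 ++ s2) => // x [/perp_cat[x1 x2] x3].
  by split.
have [U [UU FU]] := ultraFilterLemma FF.
have [c cE] : exists c : R[i]^o, (inner (T x) x : R[i]^o) @[x --> U] --> c.
  apply: (@ultra_cvg _ _ _ _ M); apply: FU; exists [::] => // x [_ x1].
  apply: le_trans (rnorm_inner _ _) _; rewrite x1 mulr1.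
  by apply: le_trans (TM _) _; rewrite x1 mulr1.
exists c => eps eps0.
have e2 : 0 < eps / 2 by rewrite divr_gt0.
have [s sT] := diag _ e2; exists s => x xs x1.
rewrite rnormBC; apply: cvg_lim_rnorm cE _; apply: FU; exists s => // y [ys y1].
have [z [/perp_cons[zx /perp_cons[zy zs]] z1]] := inf [:: x, y & s].
rewrite /= -(subrKA (inner (T z) z)); apply: le_trans (rnormD _ _) _.
rewrite [eps]splitr lerD// ltW//; first by rewrite rnormBC; apply: sT.
exact: sT.
Qed.

Lemma polarization T x y : 4 * inner (T x) y =
  inner (T (x + y)) (x + y) - inner (T (x - y)) (x - y) +
  'i%C * (inner (T (x + 'i%C *: y)) (x + 'i%C *: y) -
          inner (T (x - 'i%C *: y)) (x - 'i%C *: y)).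
Proof.
have ii : 'i%C * 'i%C = -1 :> R[i] by rewrite -expr2 sqr_i.
have iJ : Num.conj 'i%C = - 'i%C :> R[i].
  by apply/eqP; rewrite eq_complex /= oppr0 !eqxx.
have TZ z : T ('i%C *: z) = 'i%C *: T z by rewrite linearZ.
rewrite !(linearB T, linearD T, TZ).
rewrite !(innerBl, innerBr, innerDl, innerDr, innerZl, innerZr) !iJ.
set a := inner (T x) x; set b := inner (T x) y.
set a' := inner (T y) x; set b' := inner (T y) y.
transitivity (2 * b - 2 * b * ('i%C * 'i%C) + 2 * a' * (1 + 'i%C * 'i%C)).
  by rewrite ii; ring.
ring.
Qed.

(** By polarization: for unit [x] and [y] the four vectors involved have norm at
    most [2], so each contributes at most [4 * eps] to [4 * inner (T x) y]. *)
Lemma small_diagonal_form T s (eps : R) : 0 <= eps ->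
  (forall x, perp x s -> rnorm x = 1 -> rnorm (inner (T x) x) <= eps) ->
  forall x y, perp x s -> perp y s ->
    rnorm (inner (T x) y) <= 4 * eps * rnorm x * rnorm y.
Proof.
move=> eps0 Ts.
have TZ a z : T (a *: z) = a *: T z by rewrite linearZ.
have perpZ a x : perp x s -> perp (a *: x) s.
  by move=> xs v vs; rewrite innerZl xs// mulr0.
have perpD x y : perp x s -> perp y s -> perp (x + y) s.
  by move=> xs ys v vs; rewrite innerDl xs// ys// addr0.
have quad x : perp x s -> rnorm (inner (T x) x) <= eps * rnorm x ^+ 2.
  move=> xs; have [x0|x0] := eqVneq (rnorm x) 0.
    by rewrite x0 expr0n mulr0 (rnorm0_eq0 x0) [inner _ 0]linear0r rnorm0.
  have := Ts _ (perpZ (rnorm x)^-1%:C _ xs) (rnorm_normalize x0).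
  rewrite TZ innerZl innerZr !rnormM rnorm_conj rnorm_real.
  rewrite ger0_norm ?invr_ge0 ?rnorm_ge0// mulrA -invfM mulrC ler_pdivrMr//.
  by rewrite -expr2 exprn_gt0// lt_neqAle eq_sym x0 rnorm_ge0.
have unit x y : perp x s -> perp y s -> rnorm x = 1 -> rnorm y = 1 ->
    rnorm (inner (T x) y) <= 4 * eps.
  move=> xs ys x1 y1.
  have q z : perp z s -> rnorm z = 1 -> rnorm (inner (T (x + z)) (x + z)) <=
      eps * 4.
    move=> zs z1; apply: le_trans (quad _ (perpD _ _ xs zs)) _.
    rewrite ler_wpM2l//; have := rnormD x z; rewrite x1 z1.
    by have := rnorm_ge0 (x + z) => *; nra.
  have iy : perp ('i%C *: y) s by exact: perpZ.
  have iy1 : rnorm ('i%C *: y) = 1 by rewrite rnormZ rnorm_i mul1r.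
  have Ny z : perp z s -> perp (- z) s by rewrite -scaleN1r; exact: perpZ.
  have := q _ ys y1; have := q _ (Ny _ ys); rewrite rnormN => /(_ y1).
  have := q _ iy iy1; have := q _ (Ny _ iy); rewrite rnormN => /(_ iy1).
  have : rnorm (4 * inner (T x) y) = 4 * rnorm (inner (T x) y).
    rewrite rnormM; congr (_ * _).
    by rewrite (_ : 4 = 4%:C) ?rnorm_real ?ger0_norm// rmorph_nat.
  rewrite polarization => b4 h1 h2 h3 h4.
  have := rnormD (inner (T (x + y)) (x + y) - inner (T (x - y)) (x - y))
    ('i%C * (inner (T (x + 'i%C *: y)) (x + 'i%C *: y) -
          inner (T (x - 'i%C *: y)) (x - 'i%C *: y))).
  rewrite b4 rnormM rnorm_i mul1r.
  have := rnormB (inner (T (x + y)) (x + y)) (inner (T (x - y)) (x - y)).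
  have := rnormB (inner (T (x + 'i%C *: y)) (x + 'i%C *: y))
                 (inner (T (x - 'i%C *: y)) (x - 'i%C *: y)).
  by move=> *; lra.
move=> x y xs ys.
have [x0|x0] := eqVneq (rnorm x) 0.
  by rewrite x0 mulr0 mul0r (rnorm0_eq0 x0) linear0 [inner _ _]linear0l rnorm0.
have [y0|y0] := eqVneq (rnorm y) 0.
  by rewrite y0 mulr0 (rnorm0_eq0 y0) [inner _ _]linear0r rnorm0.
have := unit _ _ (perpZ (rnorm x)^-1%:C _ xs) (perpZ (rnorm y)^-1%:C _ ys)
  (rnorm_normalize x0) (rnorm_normalize y0).
rewrite TZ innerZl innerZr !rnormM rnorm_conj !rnorm_real.
rewrite !ger0_norm ?invr_ge0 ?rnorm_ge0// mulrA -invfM mulrC.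
rewrite ler_pdivrMr ?mulrA//.
by rewrite mulr_gt0// lt_neqAle eq_sym ?x0 ?y0 rnorm_ge0.
Qed.

(** Subtracting the limit [c] of the diagonal leaves an operator whose
    compressions are small. *)
Lemma wap_op_compact_add_scalar T : continuous T ->
  (forall xi eta, WAP (orbit_coef xi eta T)) ->
  exists c : R[i], precompact ((T \- (c \*: idfun)) @` [set x | `|x| <= 1]) /\
    continuous (T \- (c \*: idfun)).
Proof.
move=> /continuous_linear_rnormP [M M0 TM] wT.
have [c cP] := diagonal_limit M0 TM (wap_op_diagonal wT); exists c.
pose K : {linear H -> H} := T \- (c \*: idfun).
have cK : continuous K.
  apply/continuous_linear_rnormP; exists (M + rnorm c) => [|x].
    by rewrite addr_ge0 ?rnorm_ge0.
  apply: le_trans (rnormB _ _) _; rewrite mulrDl lerD//.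
  by rewrite /= rnormZ lexx.
split=> //; apply: (small_compression_compact cK) => e e0.
have e4 : 0 < e / 4 by rewrite divr_gt0.
have [s sP] := cP _ e4; have [s' os' ss'] := gram_schmidt s.
exists s' => // x y /ss' xs /ss' ys.
have := @small_diagonal_form K s (e / 4) (ltW e4) _ _ _ xs ys.
rewrite mulrCA mulfV ?pnatr_eq0// mulr1; apply => {xs ys} z zs z1.
rewrite [inner _ _](_ : _ = inner (T z) z - c) ?sP//.
by rewrite /K /= innerBl innerZl innerE z1 expr1n mulr1.
Qed.

End converse.

Theorem theorem1p4 (R : realType) (H : hilbertType R) : separable H ->
  wap_op H =
  [set (K \+ L : {linear H -> H}) | K in compact_op H & L in scalar_op H].
Proof.
move=> _; rewrite eqEsubset; split=> [T [cT wT]|_ [K [cK pK] [_ [c _ <-]] <-]].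
  have [c [pK cK]] := wap_op_compact_add_scalar cT wT.
  exists (T \- (c \*: idfun)) => //; exists (c \*: idfun); first by exists c.
  by apply: linear_ext => x /=; rewrite subrK.
split; last exact: (compact_add_scalar_wap (c := c) cK pK).
have [M M0 KM] := (continuous_linear_rnormP K).1 cK.
apply/continuous_linear_rnormP; exists (M + rnorm c) => [|x].
  by rewrite addr_ge0 ?rnorm_ge0.
apply: le_trans (rnormD _ _) _; rewrite mulrDl lerD//.
by rewrite /= rnormZ lexx.
Qed.
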